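(* Let $g_1,g_2\in(\mathfrak{H}\oplus\mathfrak{H})^{\odot p}$ and let $$g_1+\mathrm{i}g_2=\sum_{\mathbf{m},\mathbf{n}\in\Lambda,\,|\mathbf{m}|+|\mathbf{n}|=p}\tilde c(\mathbf{m};\mathbf{n})\,\mathrm{symm}\Big(\otimes_{k=1}^\infty\big(u_{1,0}(k)^{\otimes m_k}\otimes v_{1,0}(k)^{\otimes n_k}\big)\Big)$$ be its expansion, where $\tilde c(\mathbf{m};\mathbf{n})\in\mathbb{C}$ is the unique family of coefficients, satisfying $\sum_{|\mathbf{m}|+|\mathbf{n}|=p}|\tilde c(\mathbf{m};\mathbf{n})|^2<\infty$, for which this holds. Then $I_p(g_1)+\mathrm{i}I_p(g_2)$ admits the representation $$I_p(g_1)+\mathrm{i}I_p(g_2)=\sum_{l=0}^p\mathcal{I}_{l,p-l}(\tilde g_{l,p-l}),$$ where $\tilde g_{l,p-l}\in\mathfrak{H}_{\mathbb{C}}^{\odot l}\otimes\mathfrak{H}_{\mathbb{C}}^{\odot(p-l)}$, $0\le l\le p$, are defined as $$\tilde g_{l,p-l}=\sum_{\mathbf{m},\mathbf{n}\in\Lambda,\,|\mathbf{m}|+|\mathbf{n}|=p}\tilde c(\mathbf{m};\mathbf{n})\,g_{l,p-l}(\mathbf{m},\mathbf{n}).$$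
   Context: $\mathfrak{H}$ is a real separable Hilbert space, $\mathfrak{H}_{\mathbb{C}}$ its complexification (inner product linear in the first variable), $\mathfrak{H}\oplus\mathfrak{H}$ the Hilbert direct sum; $^{\odot n}$ is the $n$-th symmetric tensor power, $\mathrm{symm}$ the symmetrization. $X$, $Y$ are two independent isonormal Gaussian processes over $\mathfrak{H}$ (centered Gaussian families with $\mathbb{E}[X(h)X(g)]=\langle h,g\rangle_{\mathfrak{H}}$, likewise $Y$). $W(h,f)=X(h)+Y(f)$ is an isonormal Gaussian process over $\mathfrak{H}\oplus\mathfrak{H}$. For $\mathfrak{h}=f+\mathrm{i}g\in\mathfrak{H}_{\mathbb{C}}$ put $X_{\mathbb{C}}(\mathfrak{h})=X(f)+\mathrm{i}X(g)$, similarly $Y_{\mathbb{C}}$, and $Z(\mathfrak{h})=(X_{\mathbb{C}}(\mathfrak{h})+\mathrm{i}Y_{\mathbb{C}}(\mathfrak{h}))/\sqrt2$ (complex isonormal Gaussian process). $\Lambda$ is the set of sequences $\mathbf{a}=\{a_k\}_{k\ge1}$ of non-negative integers with finite sum $|\mathbf{a}|=\sum_k a_k$; $\mathbf{a}\le\mathbf{b}$ and $\mathbf{a}+\mathbf{b}$ are componentwise. Real integrals: Hermite polynomials are defined by $\exp\{tx-t^2/2\}=\sum_n \frac{t^n}{n!}H_n(x)$. For a complete orthonormal system $\{\eta_k\}$ of $\mathfrak{H}\oplus\mathfrak{H}$, $I_n$ (the real Wiener-Itô integral with respect to $W$) is the linear isometry from $(\mathfrak{H}\oplus\mathfrak{H})^{\odot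 n}$ with norm $\sqrt{n!}\|\cdot\|$ onto the $n$-th Wiener chaos of $W$ given by $I_n(\mathrm{symm}(\otimes_k\eta_k^{\otimes m_k}))=\prod_kH_{m_k}(W(\eta_k))$, $|\mathbf{m}|=n$; $I_0$ is the identity. Complex integrals: complex Hermite polynomials are defined by $\exp\{\lambda\bar z+\bar\lambda z-2|\lambda|^2\}=\sum_{p,q\ge0}\frac{\bar\lambda^p\lambda^q}{p!q!}J_{p,q}(z)$. For a complete orthonormal system $\{\xi_k\}$ of $\mathfrak{H}_{\mathbb{C}}$, $\mathcal{I}_{p,q}$ is the linear isometry from $\mathfrak{H}_{\mathbb{C}}^{\odot p}\otimes\mathfrak{H}_{\mathbb{C}}^{\odot q}$ with norm $\sqrt{p!q!}\|\cdot\|$ into $L^2_{\mathbb{C}}(\Omega)$ given by $\mathcal{I}_{p,q}(\mathrm{symm}(\otimes_k\xi_k^{\otimes p_k})\otimes\mathrm{symm}(\otimes_k\overline{\xi}_k^{\otimes q_k}))=\prod_k2^{-(p_k+q_k)/2}J_{p_k,q_k}(\sqrt2Z(\xi_k))$, $|\mathbf p|=p,|\mathbf q|=q$. $\{e_k=e_k^1+\mathrm{i}e_k^2\}_{k\ge1}$ ($e_k^1,e_k^2\in\mathfrak{H}$) is a complete orthogonal system in $\mathfrak{H}_{\mathbb{C}}$ with $\|e_k\|=\sqrt2$; $u_{1,0}(k)=\frac1{\sqrt2}(e_k^1,-e_k^2)$, $v_{1,0}(k)=\frac1{\sqrt2}(e_k^2,e_k^1)$; $\{u_{1,0}(k),v_{1,0}(k)\}_{k\ge1}$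 is a complete orthonormal basis of $\mathfrak{H}\oplus\mathfrak{H}$. For $\mathbf{m},\mathbf{n}\in\Lambda$ with $|\mathbf{m}|+|\mathbf{n}|=p$ put $\mathbf{p}=\{p_k\}=\mathbf{m}+\mathbf{n}$, $\tilde a_{k,j}=\frac{\mathrm{i}^{n_k}}{2^{p_k}}\sum_{r+s=j}\binom{m_k}{r}\binom{n_k}{s}(-1)^s$, and for $0\le l\le p$ $$g_{l,p-l}(\mathbf{m},\mathbf{n})=\sum_{\mathbf{j}\in\Lambda,\,\mathbf{j}\le\mathbf{p},\,|\mathbf{j}|=l}\Big(\prod_{i=1}^\infty\tilde a_{i,j_i}\Big)\mathrm{symm}\Big(\otimes_{k=1}^\infty e_k^{\otimes j_k}\Big)\otimes\mathrm{symm}\Big(\otimes_{k=1}^\infty\overline e_k^{\otimes(p_k-j_k)}\Big).$$ *)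

(* Defs.v *)
From HB Require Import structures.
From mathcomp Require Import all_boot all_order all_algebra all_fingroup finmap.
From mathcomp Require Import complex.
From mathcomp Require Import all_classical all_reals all_analysis.
From mathcomp.analysis.showcase Require Import summability.

Set Implicit Arguments.
Unset Strict Implicit.
Unset Printing Implicit Defensive.

Import Order.TTheory GRing.Theory Num.Theory.
Import numFieldNormedType.Exports.

Local Open Scope classical_set_scope.
Local Open Scope ring_scope.
Local Open Scope complex_scope.

(* A Hilbert space over K is a complete normed module whose norm comes from
   the inner product [dot], which is linear in its first variable and
   [theta]-semilinear in the second one. *)
Definition hilbert_dot (K : numDomainType) (theta : K -> K)
    (V : normedModType K) (dot : {dot V for theta}) : Prop :=
  forall x, dot x x = `|x| ^+ 2.

Definition separable_space (T : topologicalType) : Prop :=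
  exists D : set T, countable D /\ dense D.

(* Complete orthogonal system of vectors of squared norm [c]; it is complete
   (total) when only 0 is orthogonal to all of its members. *)
Definition complete_orthogonal (K : pzRingType) (V : zmodType)
    (dot : V -> V -> K) (c : K) (e : nat -> V) : Prop :=
  (forall j k, dot (e j) (e k) = if j == k then c else 0) /\
  (forall x, (forall k, dot x (e k) = 0) -> x = 0).

Definition complete_orthonormal (K : pzRingType) (V : zmodType)
    (dot : V -> V -> K) : (nat -> V) -> Prop :=
  complete_orthogonal dot 1.

(* Inner product of the Hilbert direct sum. The library's topology on H * H,
   given by the max norm, is the one defined by this inner product. *)
Definition dsum_dot (K : pzRingType) (H : Type) (dot : H -> H -> K)
    (x y : H * H) : K :=
  dot x.1 y.1 + dot x.2 y.2.

(* [(f, g) : complexification V] stands for f + i g. *)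
Section ComplexificationAlgebra.
Context (R : rcfType) (V : lmodType R).

Definition complexification : Type := (V * V)%type.
HB.instance Definition _ := GRing.Zmodule.copy complexification (V * V)%type.

Definition complexification_scale (a : R[i]) (x : complexification) :
    complexification :=
  (complex.Re a *: x.1 - complex.Im a *: x.2,
   complex.Im a *: x.1 + complex.Re a *: x.2).

Lemma complexification_scaleA a b x :
  complexification_scale a (complexification_scale b x) =
  complexification_scale (a * b) x.
Proof.
case: a b x => [a1 a2] [b1 b2] [x1 x2].
rewrite /complexification_scale /=.
rewrite !(scalerBr, scalerDr, scalerA, scalerBl, scalerDl).
congr (_, _); first by rewrite !opprD addrACA.
by rewrite addrACA [E in E + _ = _]addrC [E in _ + E = _]addrC.
Qed.

Lemma complexification_scale1 : left_id 1 complexification_scale.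
Proof.
by case=> x1 x2; rewrite /complexification_scale /= !scale1r !scale0r subr0 add0r.
Qed.

Lemma complexification_scaleDr : right_distributive complexification_scale +%R.
Proof.
case=> [a1 a2] [x1 x2] [y1 y2]; rewrite /complexification_scale /= !scalerDr.
by congr (_, _); rewrite ?opprD addrACA.
Qed.

Lemma complexification_scaleDl x :
  {morph complexification_scale^~ x : a b / a + b}.
Proof.
case: x => [x1 x2] [a1 a2] [b1 b2].
rewrite /complexification_scale /= !scalerDl.
by congr (_, _); rewrite ?opprD addrACA.
Qed.

HB.instance Definition _ := GRing.Zmodule_isLmodule.Build R[i] complexification
  complexification_scaleA complexification_scale1 complexification_scaleDr
  complexification_scaleDl.

Definition complexify (x : V) : complexification := (x, 0).

Definition complexification_conj (x : complexification) : complexification :=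
  (x.1, - x.2).

Definition complexification_dot (dot : V -> V -> R) (x y : complexification) :
    R[i] :=
  (dot x.1 y.1 + dot x.2 y.2) +i* (dot x.2 y.1 - dot x.1 y.2).

End ComplexificationAlgebra.

HB.instance Definition _ (R : realType) (V : normedModType R) :=
  Topological.copy (complexification V) (V * V)%type.

Definition lspan (K : pzRingType) (V : lmodType K) (A : set V) : set V :=
  [set v | exists n (c : 'I_n -> K) (x : 'I_n -> V),
     (forall i, A (x i)) /\ v = \sum_(i < n) c i *: x i].

(* [tens] makes T the n-th Hilbert tensor power of V, with [tens x] in the role
   of x_0 (x) ... (x) x_(n-1). These properties determine (T, tens) up to a
   unique unitary isomorphism. *)
Record hilbert_tensor_power (K : numFieldType) (V : lmodType K)
    (dotV : V -> V -> K) (T : normedModType K) (dotT : T -> T -> K)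
    (n : nat) (tens : ('I_n -> V) -> T) : Prop := HilbertTensorPower {
  tensor_multilinear : forall (x : 'I_n -> V) (i : 'I_n) (a : K) (u v : V),
    tens (dfwith x i (a *: u + v)) =
    a *: tens (dfwith x i u) + tens (dfwith x i v);
  tensor_dot : forall x y : 'I_n -> V,
    dotT (tens x) (tens y) = \prod_(i < n) dotV (x i) (y i);
  tensor_dense : closure (lspan (range tens)) = setT }.

Section Symmetrization.
Context (K : numFieldType) (V : lmodType K) (T : normedModType K).

Definition symm n (tens : ('I_n -> V) -> T) (x : 'I_n -> V) : T :=
  n`!%:R^-1 *: \sum_(s : 'S_n) tens (fun i => x (s i)).

Definition symmetric_power n (tens : ('I_n -> V) -> T) : set T :=
  closure (lspan (range (symm tens))).

Definition join_ord a b (x : 'I_a -> V) (y : 'I_b -> V) (i : 'I_(a + b)) : V :=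
  match fintype.split i with inl j => x j | inr k => y k end.

(* symm(x) (x) symm(y), as an element of V^{(x) (a + b)}. *)
Definition symm_symm a b (tens : ('I_(a + b) -> V) -> T)
    (x : 'I_a -> V) (y : 'I_b -> V) : T :=
  (a`! * b`!)%:R^-1 *: \sum_(s : 'S_a) \sum_(t : 'S_b)
    tens (join_ord (fun i => x (s i)) (fun i => y (t i))).

(* V^{(.) a} (x) V^{(.) b}, as a closed subspace of V^{(x) (a + b)}. *)
Definition bisymmetric_power a b (tens : ('I_(a + b) -> V) -> T) : set T :=
  closure (lspan [set v | exists x y, v = symm_symm tens x y]).

End Symmetrization.

(* The sequences are indexed from 0 instead of 1. *)
Definition multiindex := {fsfun nat -> nat with 0%N}.

Definition mdeg (a : multiindex) : nat := (\sum_(k <- finsupp a) a k)%N.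

Definition madd (a b : multiindex) : multiindex :=
  [fsfun k in (finsupp a `|` finsupp b)%fset => (a k + b k)%N].

Definition msub (a b : multiindex) : multiindex :=
  [fsfun k in finsupp a => (a k - b k)%N].

Definition mle (a b : multiindex) : Prop := forall k, (a k <= b k)%N.

(* The factors of the tensor products below come in the order of [finsupp],
   which does not matter under symmetrization; the default value 0 of [nth] is
   only reached when n exceeds the degree. *)

(* (x)_k e_k^{(x) a_k}, where n = mdeg a *)
Definition mpower (V : zmodType) (e : nat -> V) (a : multiindex) (n : nat) :
    'I_n -> V :=
  fun i => nth 0 (flatten [seq nseq (a k) (e k) | k <- finsupp a]) i.

(* (x)_k (u_k^{(x) a_k} (x) v_k^{(x) b_k}), where n = mdeg a + mdeg b *)
Definition mpower2 (V : zmodType) (u v : nat -> V) (a b : multiindex)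
    (n : nat) : 'I_n -> V :=
  fun i => nth 0 (flatten [seq nseq (a k) (u k) ++ nseq (b k) (v k)
                          | k <- finsupp (madd a b)]) i.

Definition hermite_polynomials (R : realType) (He : nat -> R -> R) : Prop :=
  forall t x : R,
    series (fun n => t ^+ n / n`!%:R * He n x) @ \oo
      --> expR (t * x - t ^+ 2 / 2).

(* The exponent lambda z^* + lambda^* z - 2 |lambda|^2 is real, so that its
   exponential is that of its real part. *)
Definition complex_hermite_polynomials (R : realType)
    (J : nat -> nat -> R[i] -> R[i]) : Prop :=
  forall lambda z : R[i],
    partial_sum (fun pq : nat * nat =>
        lambda^* ^+ pq.1 * lambda ^+ pq.2 / (pq.1`! * pq.2`!)%:R
          * J pq.1 pq.2 z : (R[i])^o) @ totally
      --> ((expR (complex.Re (lambda * z^* + lambda^* * z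
                              - 2 * `|lambda| ^+ 2)))%:C : (R[i])^o).

Section GaussianProcesses.
Context d (Omega : measurableType d) (R : realType) (P : probability Omega R).

(* The normal law N(0, s^2); [normal_prob] is not meant to be used with s = 0,
   for which the law is the Dirac measure at 0. *)
Definition centered_gaussian (U : Omega -> R) : Prop :=
  exists s : R, 0 <= s /\
    forall A : set R, measurable A ->
      P (U @^-1` A) = if s == 0 then \d_(0 : R) A else normal_prob 0 s A.

Definition isonormal (H : Type) (dot : H -> H -> R) (X : H -> {RV P >-> R}) :
    Prop :=
  (forall n (a : 'I_n -> R) (h : 'I_n -> H),
     centered_gaussian (fun w => \sum_(i < n) a i * X (h i) w)) /\
  (forall h g : H, ('E_P[fun w => (X h w * X g w)%R] = (dot h g)%:E)%E).

Definition sigma_process (H : Type) (X : H -> {RV P >-> R}) :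
    set (set Omega) :=
  <<s [set E | exists h A, measurable A /\ E = X h @^-1` A] >>.

Definition independent_processes (H : Type) (X Y : H -> {RV P >-> R}) : Prop :=
  forall E F, sigma_process X E -> sigma_process Y F ->
    P (E `&` F) = (P E * P F)%E.

Section Processes.
Context (H : lmodType R) (X Y : H -> {RV P >-> R}).

Definition process_W (h : H * H) (w : Omega) : R := X h.1 w + Y h.2 w.

Definition process_Z (h : complexification H) (w : Omega) : R[i] :=
  ((X h.1 w +i* X h.2 w) + 'i * (Y h.1 w +i* Y h.2 w)) / (Num.sqrt 2)%:C.

End Processes.

(* [I] is only constrained on the p-th symmetric tensor power, and random
   variables are compared almost surely, as elements of L^2. *)
Record wiener_ito_integral (V : lmodType R) (dotV : V -> V -> R)
    (W : V -> Omega -> R) (He : nat -> R -> R) (T : normedModType R) (p : nat)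
    (tens : ('I_p -> V) -> T) (I : T -> {RV P >-> R}) : Prop :=
  WienerItoIntegral {
  wiener_ito_linear : forall (a : R) (f g : T),
    symmetric_power tens f -> symmetric_power tens g ->
    {ae P, forall w, I (a *: f + g) w = a * I f w + I g w};
  wiener_ito_isometry : forall f : T, symmetric_power tens f ->
    ('E_P[fun w => (I f w ^+ 2)%R] = (p`!%:R * `|f| ^+ 2)%:E)%E;
  wiener_ito_hermite : forall (eta : nat -> V) (m : multiindex),
    complete_orthonormal dotV eta -> mdeg m = p ->
    {ae P, forall w, I (symm tens (@mpower V eta m p)) w =
      \prod_(k <- finsupp m) He (m k) (W (eta k) w)} }.

(* [conjV] is the complex conjugation of V. *)
Record complex_wiener_ito_integral (V : lmodType R[i]) (conjV : V -> V)
    (dotV : V -> V -> R[i]) (Z : V -> Omega -> R[i])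
    (J : nat -> nat -> R[i] -> R[i]) (T : normedModType R[i]) (p q : nat)
    (tens : ('I_(p + q) -> V) -> T) (I : T -> Omega -> R[i]) : Prop :=
  ComplexWienerItoIntegral {
  complex_wiener_ito_measurable : forall f : T, bisymmetric_power tens f ->
    measurable_fun setT (fun w => complex.Re (I f w)) /\
    measurable_fun setT (fun w => complex.Im (I f w));
  complex_wiener_ito_linear : forall (a : R[i]) (f g : T),
    bisymmetric_power tens f -> bisymmetric_power tens g ->
    {ae P, forall w, I (a *: f + g) w = a * I f w + I g w};
  complex_wiener_ito_isometry : forall f : T, bisymmetric_power tens f ->
    ('E_P[fun w => (Normc.normc (I f w) ^+ 2)%R] =
      ((p`! * q`!)%:R * complex.Re (`|f| ^+ 2))%:E)%E;
  complex_wiener_ito_hermite : forall (xi : nat -> V) (a b : multiindex),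
    complete_orthonormal dotV xi -> mdeg a = p -> mdeg b = q ->
    {ae P, forall w,
      I (symm_symm tens (@mpower V xi a p)
                        (@mpower V (fun k => conjV (xi k)) b q)) w =
      \prod_(k <- finsupp (madd a b))
        (((Num.sqrt 2)%:C ^- (a k + b k)) *
           J (a k) (b k) ((Num.sqrt 2)%:C * Z (xi k) w))} }.

End GaussianProcesses.

Definition u10 (R : realType) (H : lmodType R)
    (e : nat -> complexification H) (k : nat) : H * H :=
  (Num.sqrt 2)^-1 *: ((e k).1, - (e k).2).

Definition v10 (R : realType) (H : lmodType R)
    (e : nat -> complexification H) (k : nat) : H * H :=
  (Num.sqrt 2)^-1 *: ((e k).2, (e k).1).

Definition atilde (R : realType) (m n : multiindex) (k j : nat) : R[i] :=
  'i ^+ n k / 2 ^+ madd m n k *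
    \sum_(r < j.+1) \sum_(s < j.+1 | (r + s)%N == j)
      'C(m k, r)%:R * 'C(n k, s)%:R * (-1) ^+ s.

(* The set of multi-indices summed over is finite; the factors of the product
   that are left out are equal to 1. *)
Definition kernel_g (R : realType) (H : lmodType R)
    (e : nat -> complexification H) (T : normedModType R[i]) (l q : nat)
    (tens : ('I_(l + q) -> complexification H) -> T) (m n : multiindex) : T :=
  \sum_(j \in [set j : multiindex | mle j (madd m n) /\ mdeg j = l])
    (\prod_(k <- finsupp (madd m n)) atilde R m n k (j k)) *:
      symm_symm tens
        (@mpower _ e j l)
        (@mpower _ (fun k => complexification_conj (e k))
                   (msub (madd m n) j) q).

(* Main.v *)
(* Since W(u_k) + i W(v_k) = Z(e_k), the integrals of a basis tensor are products
   over k, and for these the claim reduces to the two-variable identity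
     H_m(x) H_n(y) = sum_j a_j J_{j, m+n-j}(x + i y),  a_j = hermite_coef m n j.
   For lambda = r (1 + i tau) with r and tau real, the generating function of
   the J_{p,q}(x + i y) is a product of two Hermite generating functions in r;
   comparing the coefficients of r^(m+n) gives a polynomial identity in tau,
   whose coefficients are the identity above.
   The kernels g_{l,p-l}(m,n) with distinct sums m + n are orthogonal, and at most
   2^p of them share the same sum, so that a Schur test turns the square
   summability of the c(m;n) into convergence of the series defining the
   g~_{l,p-l}. The identity then passes from finite partial sums to the limit by
   the isometry properties. *)

Require Import Defs.
From mathcomp Require Import all_boot all_order all_algebra all_fingroup finmap.
From mathcomp Require Import complex.
From mathcomp Require Import all_classical all_reals all_analysis.
From mathcomp.analysis.showcase Require Import summability.
From mathcomp Require Import measurable_realfun ring lra zify.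

Set Implicit Arguments.
Unset Strict Implicit.
Unset Printing Implicit Defensive.

Import Order.TTheory GRing.Theory Num.Theory.
Import numFieldNormedType.Exports.

Local Open Scope classical_set_scope.
Local Open Scope ring_scope.
Local Open Scope complex_scope.

(** * Hermite polynomials *)

(** Both families of Hermite polynomials are given only by the pointwise sums of their generating
    series. No such series is multiplied: a series with sum exp(a r - b r^2/2) solves a linear
    equation in r, so its coefficients obey (n+1) f_(n+1) = a f_n - b f_(n-1) with f_0 = 1, and
    products and rescalings are carried out on these recurrences by algebra alone. The ray turns the
    double series into a power series in one real variable, with exponent (2 r x - (2r)^2/2) + (2 r
    tau y - (2 r tau)^2/2): two Hermite exponents, at the arguments 2r and 2 r tau. The coefficients
    read off in this way involve binomials of j and m+n-j, whereas the definition has binomials of m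
    and n; the duality of Krawtchouk polynomials relates the two. The integrals obey their rules
    only up to null sets that depend on the tensors. The limit is therefore not taken outcome by
    outcome: the difference of the two sides is shown to have second moment below every positive
    bound, using one finite partial sum for each bound. *)

Definition preceding (V : zmodType) (c : nat -> V) n :=
  if n is m.+1 then c m else 0.

Section HermiteSeries.
Context (R : realType).
Implicit Types (c : nat -> R).

Lemma cvg_pseries_diffs c : (forall r, cvgn (pseries c r)) ->
  forall r, cvgn (pseries (pseries_diffs c) r).
Proof.
(* The factor 2 absorbs n+1 <= 2^(n+1), and the + 1 gives |r|^n <= (|r|+1)^(n+1). Absolute
   convergence at [y] comes from convergence at y+1. *)
move=> cc r; set y := 2 * (`|r| + 1).
have y0 : 0 < y by rewrite mulr_gt0// ltr_wpDl.
have /is_cvg_pseries_inside_norm -/(_ y) := cc (y + 1).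
rewrite (gtr0_norm y0) (@ger0_norm _ (y + 1)) ?addr_ge0 ?(ltW y0)// ltrDl ltr01.
move=> /(_ isT) cy; apply: normed_cvg.
apply: (@series_le_cvg _ _ (fun n => `|c n.+1| * y ^+ n.+1)) => //=.
- by move=> n; rewrite mulr_ge0// exprn_ge0// ltW.
- move=> n; rewrite /pseries_diffs !normrM normrX normr_nat mulrAC mulrC.
  rewrite ler_wpM2l// exprMn ler_pM//.
    by rewrite -natrX ler_nat ltnW// ltn_expl.
  apply: (@le_trans _ _ ((`|r| + 1) ^+ n)).
    by rewrite lerXn2r// ?qualifE/= ?addr_ge0// lerDl.
  by rewrite exprS ler_peMl ?exprn_ge0 ?addr_ge0// lerDr.
have : cvgn (series (fun n => `|c n| * y ^+ n)) := cy.
rewrite -(is_cvg_series_restrict 1) => /cvg_ex[l cl]; apply/cvg_ex; exists l.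
move: cl; rewrite -cvg_shiftS.
by under eq_fun do rewrite /= big_add1.
Qed.

Lemma pseries_is_derive c (f : R -> R) :
  (forall r, pseries c r @ \oo --> f r) -> forall r,
  is_derive r (1 : R) f (limn (pseries (pseries_diffs c) r)).
Proof.
move=> cf r; have cc s : cvgn (pseries c s) by apply/cvg_ex; exists (f s).
have -> : f = fun r => limn (pseries c r).
  by apply/funext => s; apply/esym/cvg_lim => //; exact: cf.
apply: (@pseries_snd_diffs _ _ (`|r| + 1)) => //.
- exact: cvg_pseries_diffs.
- by do 2! apply: cvg_pseries_diffs.
- by rewrite [ltRHS]ger0_norm ?addr_ge0// ltrDl.
Qed.

Lemma pseries0 c l : pseries c 0 @ \oo --> l -> c 0%N = l.
Proof.
move=> cl; have : pseries c 0 @ \oo --> c 0%N.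
  rewrite -cvg_shiftS /=.
  rewrite [X in X @ _ --> _](_ : _ = cst (c 0%N)); first exact: cvg_cst.
  apply/funext => n; rewrite /pseries /series/= big_nat_recl//= expr0 mulr1.
  by rewrite big1 ?addr0// => i _; rewrite exprS mul0r mulr0.
by move/cvg_lim => <- //; apply/cvg_lim.
Qed.

(** Differentiation shifts the coefficients, up to the nonzero factors n+1, so induction on n over
    all series at once reduces the claim to the value at 0. *)
Lemma pseries_eq0 c : (forall r, pseries c r @ \oo --> (0 : R)) ->
  forall n, c n = 0.
Proof.
move=> c0 n; elim: n c c0 => [|n IH] c c0; first exact: pseries0 (c0 0).
suff : pseries_diffs c n = 0.
  by move/eqP; rewrite mulf_eq0 pnatr_eq0/= => /eqP.
apply: IH => r; have /@derive_val := pseries_is_derive c0 r.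
rewrite derive_cst => ->.
exact: cvg_pseries_diffs (fun r => cvgP _ (c0 r)) r.
Qed.

Lemma pseries_preceding c r l : pseries c r @ \oo --> l ->
  pseries (preceding c) r @ \oo --> r * l.
Proof.
move=> cl; rewrite -cvg_shiftS /=.
rewrite [X in X @ _ --> _](_ : _ = (fun n => r * pseries c r n)).
  by apply: cvgM => //; exact: cvg_cst.
apply/funext => n; rewrite /pseries /series/= big_nat_recl//= mul0r add0r.
by rewrite mulr_sumr; apply: eq_bigr => i _; rewrite exprS mulrCA.
Qed.

(* The sum of the series solves [f' = (a - b r) f]. *)
Lemma gaussian_series_coef c K a b :
  (forall r, pseries c r @ \oo --> K * expR (a * r - b * r ^+ 2 / 2)) ->
  c 0%N = K /\ forall n, n.+1%:R * c n.+1 = a * c n - b * preceding c n.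
Proof.
move=> cf; split.
  by rewrite (pseries0 (cf 0)) mulr0 expr0n mulr0 mul0r subr0 expR0 mulr1.
(* [D] lists the coefficients of f' - a f + b r f, a series whose sum is 0 everywhere. *)
move=> n; pose D n := pseries_diffs c n - a * c n + b * preceding c n.
suff : D n = 0.
  by rewrite /D /pseries_diffs => /eqP; rewrite -addrA addr_eq0 => /eqP ->; ring.
apply: pseries_eq0 => r.
pose f r := K * expR (a * r - b * r ^+ 2 / 2).
have df : is_derive r (1 : R) f ((a - b * r) * f r).
  by apply: is_derive_eq; rewrite /f /GRing.scale/=; field.
have cd : pseries (pseries_diffs c) r @ \oo --> (a - b * r) * f r.
  have /@derive_val := pseries_is_derive cf r.
  rewrite (@derive_val _ _ _ _ _ _ _ df) => ->.
  exact: cvg_pseries_diffs (fun r => cvgP _ (cf r)) r.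
have -> : 0 = (a - b * r) * f r - a * f r + b * (r * f r) by ring.
rewrite [X in X @ _ --> _](_ : _ = (fun n => pseries (pseries_diffs c) r n
   - a * pseries c r n + b * pseries (preceding c) r n)).
  apply: cvgD; [apply: cvgB => //|]; apply: cvgM; try exact: cvg_cst.
    exact: cf.
  exact: pseries_preceding (cf r).
apply/funext => N; rewrite /pseries /series/= !mulr_sumr -sumrB -big_split/=.
by apply: eq_bigr => i _; rewrite /D; ring.
Qed.

End HermiteSeries.

(** * Algebra of the coefficients of exp(a r - b r^2/2) *)

Section GaussianRecurrence.
Context (R : numFieldType).
Implicit Types (f g : nat -> R).

(** Characterizes the coefficients of exp(a r - b r^2/2); [preceding] supplies f_(-1) = 0, so that n
    = 0 is no exception. *)
Definition gaussian_recurrence (a b : R) f :=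
  f 0%N = 1 /\ forall n, n.+1%:R * f n.+1 = a * f n - b * preceding f n.

Lemma gaussian_recurrence_inj a b f g :
  gaussian_recurrence a b f -> gaussian_recurrence a b g -> f =1 g.
Proof.
move=> [f0 fS] [g0 gS] n.
suff /andP[/eqP] : (f n == g n) && (preceding f n == preceding g n) by [].
elim: n => [|n /andP[/eqP IH1 /eqP IH2]]; first by rewrite f0 g0 /= !eqxx.
rewrite /= IH1 eqxx andbT -subr_eq0.
have : n.+1%:R * (f n.+1 - g n.+1) == 0.
  by rewrite mulrBr fS gS IH1 IH2 subrr.
by rewrite mulf_eq0 pnatr_eq0.
Qed.

(** This is the substitution of s r for r in the generating function. *)
Lemma gaussian_recurrence_scale a b s f : gaussian_recurrence a b f ->
  gaussian_recurrence (s * a) (s ^+ 2 * b) (fun n => s ^+ n * f n).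
Proof.
move=> [f0 fS]; split; first by rewrite mul1r.
move=> n; rewrite mulrCA fS exprS; case: n => [|n] /=; first by ring.
by rewrite exprS; ring.
Qed.

Definition cauchy_product f g n := \sum_(i < n.+1) f i * g (n - i)%N.

Lemma cauchy_productC f g n : cauchy_product f g n = cauchy_product g f n.
Proof.
rewrite /cauchy_product (reindex_inj rev_ord_inj)/=; apply: eq_bigr => i _.
by rewrite subSS subKn 1?mulrC// -ltnS.
Qed.

Lemma cauchy_product_preceding f g n :
  cauchy_product (preceding f) g n = preceding (cauchy_product f g) n.
Proof.
rewrite /cauchy_product big_ord_recl mul0r add0r; case: n => [|n] /=.
  by rewrite big_ord0.
by apply: eq_bigr => i _; rewrite /= /bump/= add1n subSS.
Qed.

(** Leibniz rule on coefficients: the weight n+1 = i + (n+1-i) splits the derivative of a product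
    into two halves. [half] treats one; reversing the order of summation gives the other. *)
Lemma gaussian_recurrence_mul a b a' b' f g :
  gaussian_recurrence a b f -> gaussian_recurrence a' b' g ->
  gaussian_recurrence (a + a') (b + b') (cauchy_product f g).
Proof.
have half u v h k : gaussian_recurrence u v h -> forall n,
    \sum_(i < n.+2) i%:R * (h i * k (n.+1 - i)%N) =
    u * cauchy_product h k n - v * preceding (cauchy_product h k) n.
  move=> [_ hS] n; rewrite big_ord_recl mul0r add0r -cauchy_product_preceding.
  rewrite !mulr_sumr -sumrB; apply: eq_bigr => i _.
  by rewrite /= /bump/= add1n subSS mulrA hS; ring.
move=> rf rg; split.
  by rewrite /cauchy_product big_ord1 rf.1 rg.1 mulr1.
move=> n; have -> : (a + a') * cauchy_product f g n -
    (b + b') * preceding (cauchy_product f g) n =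
    (a * cauchy_product f g n - b * preceding (cauchy_product f g) n) +
    (a' * cauchy_product g f n - b' * preceding (cauchy_product g f) n).
  rewrite (cauchy_productC g f n).
  have -> : preceding (cauchy_product g f) n = preceding (cauchy_product f g) n.
    by case: n => //= n; exact: cauchy_productC.
  by ring.
rewrite -(half _ _ _ g rf n) -(half _ _ _ f rg n).
rewrite [X in _ + X](reindex_inj rev_ord_inj)/= -big_split/= mulr_sumr.
apply: eq_bigr => i _; rewrite subSS subKn 1?mulrC; last by rewrite -ltnS.
rewrite natrB; last by rewrite -ltnS.
by ring.
Qed.

End GaussianRecurrence.

(** A nonzero difference would have as many distinct roots as its size. Natural points are
    convenient because they are the same in R and in R[i]. *)
Lemma polyP_natr (K : numFieldType) (P Q : {poly K}) :
  (forall k : nat, P.[k%:R] = Q.[k%:R]) -> P = Q.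
Proof.
move=> PQ; apply/eqP; rewrite -subr_eq0; apply/negPn/negP => D0.
pose rs : seq K := [seq k%:R | k <- iota 0 (size (P - Q))].
have rootrs : all (root (P - Q)) rs.
  by apply/allP => _ /mapP[k _ ->]; rewrite /root hornerD hornerN PQ subrr.
have uniqrs : uniq rs.
  by rewrite map_inj_uniq ?iota_uniq//; exact: mulrIn (oner_neq0 _).
by have := max_poly_roots D0 rootrs uniqrs; rewrite size_map size_iota ltnn.
Qed.

(** If j - s <= m, both sides are m! k! j! (m+k-j)! divided by s! (j-s)! (k-s)! (m-(j-s))!;
    otherwise a binomial vanishes on each side. *)
Lemma bin_fact_exchange m k j s : (j <= m + k)%N -> (s <= j)%N -> (s <= k)%N ->
  (m`! * k`! * ('C(j, s) * 'C(m + k - j, k - s)) =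
   j`! * (m + k - j)`! * ('C(m, j - s) * 'C(k, s)))%N.
Proof.
move=> jmk sj sk; have [jsm|jsm] := leqP (j - s) m; last first.
  rewrite (bin_small jsm) (@bin_small (m + k - j)) ?muln0 ?mul0n ?muln0//.
  by move: jsm; rewrite !ltnNge; apply: contra; lia.
have ej : (k - s <= m + k - j)%N by lia.
have em : (m + k - j - (k - s) = m - (j - s))%N by lia.
have := bin_fact ej; rewrite em => <-.
rewrite -(bin_fact sj) -(bin_fact jsm) -(bin_fact sk).
by ring.
Qed.

Lemma hermite_recurrence (R : realType) (He : nat -> R -> R) (x : R) :
  hermite_polynomials He ->
  gaussian_recurrence x 1 (fun n => He n x / n`!%:R).
Proof.
move=> heHe; apply: (@gaussian_series_coef R _ 1 x 1) => r.
rewrite !mul1r [x * r]mulrC.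
suff -> : pseries (fun n => He n x / n`!%:R) r =
    series (fun n => r ^+ n / n`!%:R * He n x) by exact: heHe.
apply/funext => N; rewrite /pseries /series/=. apply: eq_bigr => i _.
by rewrite mulrAC -mulrA mulrC.
Qed.

(** * Grouping a double series along antidiagonals *)

Definition antidiagonal n : seq (nat * nat) :=
  [seq (i, (n - i)%N) | i <- iota 0 n.+1].

Definition triangle N : seq (nat * nat) := flatten (map antidiagonal (iota 0 N)).

Lemma mem_antidiagonal n pq : (pq \in antidiagonal n) = (pq.1 + pq.2 == n)%N.
Proof.
apply/mapP/eqP => [[k] | <-].
  by rewrite mem_iota add0n => /andP[_ lkn] ->; rewrite /= subnKC.
exists pq.1; first by rewrite mem_iota ltnS leq_addr.
by case: pq => p q; rewrite /= addKn.
Qed.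

Lemma uniq_antidiagonal n : uniq (antidiagonal n).
Proof. by rewrite map_inj_uniq ?iota_uniq// => i j []. Qed.

Lemma mem_triangle N pq : (pq \in triangle N) = (pq.1 + pq.2 < N)%N.
Proof.
apply/flatten_mapP/idP => [[n]|h].
  by rewrite mem_iota mem_antidiagonal => /andP[_ ?] /eqP ->.
by exists (pq.1 + pq.2)%N; rewrite ?mem_iota// mem_antidiagonal.
Qed.

Lemma uniq_triangle N : uniq (triangle N).
Proof.
elim: N => // N IH.
have -> : triangle N.+1 = triangle N ++ antidiagonal N.
  rewrite /triangle -[in LHS]addn1 iotaD map_cat flatten_cat add0n.
  by rewrite -[iota N 1]/[:: N] [map _ [:: N]]/= -cat1s flatten_cat/= !cats0.
rewrite cat_uniq IH uniq_antidiagonal andbT; apply/hasPn => pq.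
by rewrite mem_antidiagonal mem_triangle => /eqP ->; rewrite ltnn.
Qed.

(* The triangles are cofinal among the finite sets of pairs, so that unconditional
   sums over pairs can be computed by grouping the terms with p + q = n. *)
Lemma cvg_triangle :
  (fun N => [fset pq in triangle N]%fset) @ \oo --> @totally (nat * nat)%type.
Proof.
move=> S [A _ AS]; pose M := (\sum_(pq <- A) (pq.1 + pq.2).+1)%N.
exists M => // N /= MN; apply: AS; apply/fsubsetP => pq pqA.
rewrite !inE mem_triangle; apply: leq_trans MN.
by rewrite /M (big_fsetD1 pq)//= leq_addr.
Qed.

Lemma partial_sum_triangle (V : zmodType) (f : nat * nat -> V) N :
  partial_sum f [fset pq in triangle N]%fset =
  \sum_(n < N) \sum_(i < n.+1) f (val i, (n - i)%N).
Proof.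
rewrite /partial_sum -(big_seq_fsetE _ _ predT)/=.
rewrite (perm_big (triangle N)); last first.
  apply: uniq_perm; rewrite ?fset_uniq ?uniq_triangle// => pq.
  by rewrite inE.
rewrite /triangle big_flatten big_map.
rewrite -(big_mkord predT (fun n => \sum_(i < n.+1) f (val i, (n - i)%N))).
rewrite /index_iota subn0; apply: eq_bigr => n _.
by rewrite big_map -(big_mkord predT (fun i => f (i, (n - i)%N))) /index_iota subn0.
Qed.

Section ComplexParts.
Context (R : realType).

Lemma ler_Re_normc (x : R[i]) : `|complex.Re x| <= Normc.normc x.
Proof.
by case: x => a b /=; rewrite -sqrtr_sqr ler_wsqrtr// lerDl sqr_ge0.
Qed.

Lemma ler_Im_normc (x : R[i]) : `|complex.Im x| <= Normc.normc x.
Proof.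
by case: x => a b /=; rewrite -sqrtr_sqr ler_wsqrtr// lerDr sqr_ge0.
Qed.

Lemma cvg_complex_parts (T : Type) (F : set_system T) {FF : Filter F}
    (f : T -> R[i]) (l : R[i]) :
  (f : T -> (R[i])^o) @ F --> (l : (R[i])^o) ->
  (complex.Re (f x) @[x --> F] --> complex.Re l) /\
  (complex.Im (f x) @[x --> F] --> complex.Im l).
Proof.
move=> /cvgrPdist_lt fl; split; apply/cvgrPdist_lt => e e0.
all: have e0' : 0 < (e%:C : R[i]) by rewrite ltcR.
all: apply: filterS (fl _ e0') => x; rewrite normc_def /= ltcR.
all: apply: le_lt_trans; rewrite -raddfB; case: (l - f x) => u v.
- exact: (ler_Re_normc (u +i* v)).
- exact: (ler_Im_normc (u +i* v)).
Qed.

End ComplexParts.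

Lemma coef_1DZXn (K : comNzRingType) (a : K) p s :
  ((1 + a *: 'X) ^+ p)`_s = 'C(p, s)%:R * a ^+ s.
Proof.
rewrite exprDn coef_sum.
transitivity (\sum_(i < p.+1) (s == i)%:R * ('C(p, i)%:R * a ^+ i)).
  apply: eq_bigr => i _; rewrite expr1n mul1r exprZn coefMn coefZ coefXn.
  by rewrite -mulr_natl; ring.
have [ps|sp] := ltnP p s.
  rewrite bin_small// mul0r big1// => i _.
  by case: eqP => [si|]; rewrite ?mul0r// -si bin_small// !mul0r mulr0.
rewrite (bigD1 (inord s))//= inordK ?ltnS// eqxx mul1r big1 ?addr0// => i.
by rewrite -val_eqE/= inordK ?ltnS// eq_sym => /negPf ->; rewrite mul0r.
Qed.

Definition hermite_coef (R : realType) (m n j : nat) : R[i] :=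
  'i ^+ n / 2 ^+ (m + n) *
    \sum_(r < j.+1) \sum_(s < j.+1 | (r + s)%N == j)
      'C(m, r)%:R * 'C(n, s)%:R * (-1) ^+ s.

(** The coefficient extracted here is i^n times the sum of (-1)^s C(j,s) C(m+n-j,n-s), whereas the
    definition contains the sum of (-1)^s C(n,s) C(m,j-s). Both are Krawtchouk sums, with degree and
    argument exchanged; [bin_fact_exchange] is their duality, term by term. *)
Lemma hermite_coefE (R : realType) (m n j : nat) : (j <= m + n)%N ->
  hermite_coef R m n j = 2 ^- (m + n) * (m`! * n`!)%:R
    * ((1 - 'i *: 'X) ^+ j * (1 + 'i *: 'X) ^+ (m + n - j))`_n
    / (j`! * (m + n - j)`!)%:R.
Proof.
move=> jmn; rewrite /hermite_coef -scaleNr coefM.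
have fact0 : (j`! * (m + n - j)`!)%:R != 0 :> R[i].
  by rewrite pnatr_eq0 muln_eq0 negb_or -!lt0n !fact_gt0.
apply: (mulIf fact0); rewrite mulfVK//.
rewrite ['i ^+ n / _]mulrC -!mulrA; congr (_ * _).
rewrite (exchange_big_dep predT)//=.
transitivity ('i ^+ n * ((\sum_(s < j.+1) 'C(m, j - s)%:R * 'C(n, s)%:R * (-1) ^+ s)
   * (j`! * (m + n - j)`!)%:R) : R[i]).
  congr (_ * (_ * _)); apply: eq_bigr => s _.
  rewrite (bigD1 (inord (j - s)))/= ?inordK ?ltnS ?leq_subr ?subnK// -1?ltnS//.
  rewrite big1 ?addr0// => r /andP[/eqP rs]; rewrite -val_eqE/= inordK ?ltnS ?leq_subr//.
  by move=> /eqP []; apply: (canRL (addnK _)).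
under [X in _ = _ * X]eq_bigr => s _.
  rewrite !coef_1DZXn.
  have -> : 'C(j, s)%:R * (- 'i) ^+ s * ('C(m + n - j, n - s)%:R * 'i ^+ (n - s)) =
     'i ^+ n * ('C(j, s)%:R * 'C(m + n - j, n - s)%:R * (-1) ^+ s) :> R[i].
    have -> : 'i ^+ n = 'i ^+ s * 'i ^+ (n - s) :> R[i].
      by rewrite -exprD subnKC// -ltnS.
    by rewrite -[- 'i]mulN1r exprMn; ring.
over.
rewrite -mulr_sumr [RHS]mulrCA; congr (_ * _).
rewrite mulrC !mulr_sumr.
pose f s : R[i] := (j`! * (m + n - j)`!)%:R * ('C(m, j - s)%:R * 'C(n, s)%:R * (-1) ^+ s).
pose g s : R[i] := (m`! * n`!)%:R * ('C(j, s)%:R * 'C(m + n - j, n - s)%:R * (-1) ^+ s).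
rewrite -(big_mkord predT f) -(big_mkord predT g).
(* The sums run over s <= j and over s <= n; beyond the minimum of j and n the terms of either one
   vanish. *)
have trunc (h : nat -> R[i]) a b : (a <= b)%N -> (forall s, (a < s <= b)%N -> h s = 0) ->
    \sum_(0 <= s < a.+1) h s = \sum_(0 <= s < b.+1) h s.
  move=> ab h0; rewrite [RHS](@big_cat_nat _ _ _ a.+1)//= [X in _ = _ + X]big_nat.
  by rewrite [X in _ + X]big1 ?addr0// => s; exact: h0.
have minj : (minn j n <= j)%N by exact: geq_minl.
have minn' : (minn j n <= n)%N by exact: geq_minr.
rewrite -(trunc f _ _ minj); last first.
  move=> s /andP[]; rewrite gtn_min => /orP[|ns _]; first by rewrite ltnNge => /negPf ->.
  by rewrite /f (bin_small ns) mulr0 mul0r mulr0.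
rewrite -(trunc g _ _ minn'); last first.
  move=> s /andP[]; rewrite gtn_min => /orP[js _|]; last by rewrite ltnNge => /negPf ->.
  by rewrite /g (bin_small js) !mul0r mulr0.
rewrite !big_nat; apply: eq_bigr => s; rewrite ltnS leq_min => /andP[_ /andP[sj sn]].
rewrite /f /g !mulrA -!natrM; congr (_%:R * _).
by rewrite -[LHS]mulnA -[RHS]mulnA bin_fact_exchange.
Qed.

(** * The product formula in two variables *)

Section HermiteProduct.
Context (R : realType) (He : nat -> R -> R) (J : nat -> nat -> R[i] -> R[i]).
Hypotheses (heHe : hermite_polynomials He) (heJ : complex_hermite_polynomials J).
Variables (x y : R).

Let z := x +i* y.

(* The coefficients of r^n on the ray lambda = r (1 + i tau). *)
Lemma complex_hermite_antidiagonal (tau : R) (n : nat) :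
  \sum_(p < n.+1) (1 - 'i * tau%:C) ^+ p * (1 + 'i * tau%:C) ^+ (n - p)
     * (J p (n - p) z / (p`! * (n - p)`!)%:R) =
  \sum_(k < n.+1) (2 ^+ n * (He k x / k`!%:R) * (He (n - k) y / (n - k)`!%:R))%:C
     * tau%:C ^+ (n - k).
Proof.
pose w : R[i] := 1 +i* tau.
pose b n := \sum_(p < n.+1) Num.conj w ^+ p * w ^+ (n - p)
     * (J p (n - p)%N z / (p`! * (n - p)`!)%:R).
pose F k := 2 ^+ k * (He k x / k`!%:R).
pose G k := (2 * tau) ^+ k * (He k y / k`!%:R).
have shuffle (K : comNzRingType) (a1 a2 a3 a4 u v : K) :
  a1 * a2 * (a3 * a4) * u * v = a2 * a4 * (v * u) * (a1 * a3) by ring.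
have bE r N : partial_sum (fun pq : nat * nat => Num.conj (r%:C * w) ^+ pq.1
    * (r%:C * w) ^+ pq.2 / (pq.1`! * pq.2`!)%:R * J pq.1 pq.2 z)
    [fset pq in triangle N]%fset = \sum_(n < N) b n * r%:C ^+ n.
  rewrite partial_sum_triangle; apply: eq_bigr => {}n _.
  rewrite /b mulr_suml; apply: eq_bigr => i _.
  have -> : Num.conj (r%:C * w) = r%:C * Num.conj w.
    by rewrite rmorphM; congr (_ * _); exact: conjc_real.
  rewrite /fst /snd.
  rewrite -[X in _ * r%:C ^+ X](@subnKC i n) 1?exprD; last by rewrite -ltnS.
  by rewrite !exprMn shuffle.
(* The exponent is left unsimplified: its parameters are the sums of those of the Hermite series in
   x at 2 r and in y at 2 tau r, as [gaussian_recurrence_mul] will produce them. *)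
have ser r : (\sum_(n < N) b n * r%:C ^+ n : (R[i])^o) @[N --> \oo] -->
    ((expR ((2 * x + 2 * tau * y) * r
       - (2 ^+ 2 * 1 + (2 * tau) ^+ 2 * 1) * r ^+ 2 / 2))%:C : (R[i])^o).
  have := cvg_comp _ _ cvg_triangle (@heJ (r%:C * w) z).
  rewrite (_ : _ \o _ = fun N => \sum_(n < N) b n * r%:C ^+ n); last first.
    by apply/funext => N; rewrite /= bE.
  set u := expR _; set v := expR _; suff -> : u = v by [].
  congr expR; rewrite sqr_normc /w /z.
  by simpc => /=; field.
(* The sum is real for every real r, so the series of imaginary parts vanishes identically and the
   real parts carry the recurrence. *)
have [Rb Ib] : gaussian_recurrence (2 * x + 2 * tau * y)
    (2 ^+ 2 * 1 + (2 * tau) ^+ 2 * 1) (fun n => complex.Re (b n)) /\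
    forall n, complex.Im (b n) = 0.
  have parts r := @cvg_complex_parts _ _ _ eventually_filter _ _ (ser r).
  have Epart : forall (part : {additive R[i] -> R}),
      (forall u (a : R), part (u * a%:C) = part u * a) -> forall r,
      (fun N => part (\sum_(n < N) b n * r%:C ^+ n)) =
      pseries (fun n => part (b n)) r.
    move=> part partM r; apply/funext => N; rewrite raddf_sum /pseries /series/=.
    by rewrite big_mkord; apply: eq_bigr => i _; rewrite -rmorphXn/= partM.
  split.
    apply: gaussian_series_coef => r; rewrite mul1r.
    have [+ _] := parts r.
    rewrite (Epart (@complex.Re R)) //.
    by case=> u1 u2 a /=; rewrite mulr0 subr0.
  apply: pseries_eq0 => r; have [_] := parts r.
  rewrite (Epart (@complex.Im R)) //.
  by case=> u1 u2 a /=; rewrite mulr0 add0r.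
have RbE n' : complex.Re (b n') = cauchy_product F G n'.
  apply: gaussian_recurrence_inj Rb _ n'; apply: gaussian_recurrence_mul.
    exact: gaussian_recurrence_scale (hermite_recurrence x heHe).
  exact: gaussian_recurrence_scale (hermite_recurrence y heHe).
have bn : b n = (cauchy_product F G n)%:C.
  by rewrite -RbE [LHS]complexE Ib mulr0 addr0.
transitivity (b n).
  have -> : 1 + 'i * tau%:C = w by rewrite -complexiE /w; simpc.
  have -> : 1 - 'i * tau%:C = Num.conj w.
    by rewrite -complexiE; transitivity (conjc w) => //; rewrite /w; simpc.
  by [].
rewrite bn rmorph_sum; apply: eq_bigr => k _.
have -> : 2 ^+ n = 2 ^+ k * 2 ^+ (n - k) :> R.
  by rewrite -exprD subnKC// -ltnS.
transitivity (((2 ^+ k * 2 ^+ (n - k) * (He k x / k`!%:R)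
    * (He (n - k)%N y / (n - k)`!%:R)) * tau ^+ (n - k))%:C).
  by congr (real_complex R); rewrite /F /G exprMn; ring.
by rewrite -[LHS]/(real_complex R _) rmorphM rmorphXn.
Qed.

Lemma hermite_mul m n :
  (He m x * He n y)%:C =
  \sum_(j < (m + n).+1) hermite_coef R m n j * J j (m + n - j) z.
Proof.
pose P : {poly R[i]} := \sum_(j < (m + n).+1)
  (J j (m + n - j) z / (j`! * (m + n - j)`!)%:R) *:
     ((1 - 'i *: 'X) ^+ j * (1 + 'i *: 'X) ^+ (m + n - j)).
pose Q : {poly R[i]} := \sum_(k < (m + n).+1)
  (2 ^+ (m + n) * (He k x / k`!%:R) * (He (m + n - k) y / (m + n - k)`!%:R))%:C
    *: 'X^(m + n - k).
have PQ : P = Q.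
  apply: polyP_natr => k; rewrite !horner_sum.
  have := complex_hermite_antidiagonal k%:R (m + n).
  rewrite (rmorph_nat (real_complex R)) => PQk.
  transitivity (\sum_(j < (m + n).+1)
      (1 - 'i * k%:R) ^+ j * (1 + 'i * k%:R) ^+ (m + n - j) *
      (J j (m + n - j) z / (j`! * (m + n - j)`!)%:R)).
    apply: eq_bigr => j _; rewrite hornerZ hornerM !horner_exp mulrC.
    by rewrite hornerD hornerN hornerC hornerZ hornerX hornerD hornerC hornerZ hornerX.
  by rewrite PQk; apply: eq_bigr => j _; rewrite hornerZ hornerXn.
have Pn : 2 ^- (m + n) * (m`! * n`!)%:R * P`_n =
    \sum_(j < (m + n).+1) hermite_coef R m n j * J j (m + n - j) z.
  rewrite coef_sum mulr_sumr; apply: eq_bigr => j _.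
  by rewrite hermite_coefE -1?ltnS// coefZ; ring.
(* Only k = m contributes to X^n in [Q], with coefficient 2^(m+n) H_m(x) H_n(y) / (m! n!), and the
   prefactor in [Pn] cancels all but the product. *)
rewrite -Pn PQ coef_sum (bigD1 (inord m))//= inordK ?ltnS ?leq_addr//.
rewrite addKn big1 ?addr0 => [|k]; last first.
  rewrite -val_eqE/= inordK ?ltnS ?leq_addr// => km; rewrite coefZ coefXn.
  case: eqP => [nk|_]; last by rewrite mulr0.
  by move: km (ltn_ord k) => /eqP km; move: nk; lia.
rewrite coefZ coefXn eqxx mulr1 !rmorphM/= !rmorphXn/= !fmorphV/= !rmorph_nat.
have fact0 k : k`!%:R != 0 :> R[i] by rewrite pnatr_eq0 -lt0n fact_gt0.
have two0 : 2 ^+ (m + n) != 0 :> R[i] by rewrite expf_neq0 ?pnatr_eq0.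
by move: (2 ^+ (m + n)) (fact0 m) (fact0 n) two0 => w f1 f2 w0; field; rewrite f1 f2 w0.
Qed.

End HermiteProduct.

(** * Multi-indices *)

Section Multiindex.
Implicit Types (a b j P : multiindex) (k : nat).

Lemma maddE a b k : madd a b k = (a k + b k)%N.
Proof.
rewrite fsfunE in_fsetU !mem_finsupp; case: eqVneq => //= ->.
by case: eqVneq => //= ->.
Qed.

Lemma msubE a b k : msub a b k = (a k - b k)%N.
Proof. by rewrite fsfunE mem_finsupp; case: eqVneq => //= ->. Qed.

Lemma maddK a b : msub (madd a b) a = b.
Proof. by apply/fsfunP => k; rewrite msubE maddE addKn. Qed.

Lemma msubK j P : mle j P -> madd j (msub P j) = P.
Proof. by move=> jP; apply/fsfunP => k; rewrite maddE msubE subnKC. Qed.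

Lemma finsupp_madd a b :
  finsupp (madd a b) = (finsupp a `|` finsupp b)%fset.
Proof.
by apply/fsetP => k; rewrite in_fsetU !mem_finsupp maddE addn_eq0 negb_and.
Qed.

Lemma mdeg_widen a (A : {fset nat}) : (finsupp a `<=` A)%fset ->
  mdeg a = (\sum_(k <- A) a k)%N.
Proof.
move=> aA; rewrite /mdeg; apply: big_fset_incl => // k _.
by move=> /fsfun_dflt.
Qed.

Lemma mdeg_madd a b : mdeg (madd a b) = (mdeg a + mdeg b)%N.
Proof.
rewrite (mdeg_widen (fsubsetUl (finsupp a) (finsupp b))).
rewrite (mdeg_widen (fsubsetUr (finsupp a) (finsupp b))).
by rewrite /mdeg finsupp_madd -big_split/=; apply: eq_bigr => k _; exact: maddE.
Qed.

Lemma mdeg_msub j P : mle j P -> mdeg (msub P j) = (mdeg P - mdeg j)%N.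
Proof. by move=> /msubK {2}<-; rewrite mdeg_madd addKn. Qed.

Lemma mle_finsupp j P : mle j P -> (finsupp j `<=` finsupp P)%fset.
Proof.
move=> jP; apply/fsubsetP => k; rewrite !mem_finsupp -!lt0n => jk.
exact: leq_trans (jP k).
Qed.

Lemma leq_mdeg j P : mle j P -> (mdeg j <= mdeg P)%N.
Proof. by move=> /msubK <-; rewrite mdeg_madd leq_addr. Qed.

Lemma leq_mdeg_coord a k : (a k <= mdeg a)%N.
Proof.
have := boolP (k \in finsupp a) => -[ka|/fsfun_dflt ->]; last by [].
by rewrite /mdeg (big_fsetD1 k)//= leq_addr.
Qed.

(** The letters are the indices of the factors of [mpower]. Words that agree up to permutation give
    the same symmetrized tensor, and they determine the multi-index ([mword_inj]). *)
Definition mword a : seq nat := flatten [seq nseq (a k) k | k <- finsupp a].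

Lemma count_flatten_nseq (a : nat -> nat) (s : seq nat) k : uniq s ->
  count_mem k (flatten [seq nseq (a i) i | i <- s]) = if k \in s then a k else 0%N.
Proof.
elim: s => //= i s IH /andP[ns us]; rewrite count_cat count_nseq IH// inE.
rewrite /=; case: (eqVneq k i) => [->|ki] /=.
  by rewrite mul1n (negPf ns) addn0 mem_head.
by rewrite mul0n add0n inE (negPf ki).
Qed.

Lemma count_mword a k : count_mem k (mword a) = a k.
Proof.
rewrite count_flatten_nseq ?fset_uniq//.
by case: finsuppP.
Qed.

Lemma size_mword a : size (mword a) = mdeg a.
Proof.
rewrite /mword size_flatten /shape -map_comp sumnE big_map.
by apply: eq_bigr => k _; rewrite /= size_nseq.
Qed.

Lemma mpowerE (V : zmodType) (f : nat -> V) a n (i : 'I_n) : mdeg a = n ->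
  mpower f a i = f (nth 0%N (mword a) i).
Proof.
move=> an; rewrite /mpower.
have -> : flatten [seq nseq (a k) (f k) | k <- finsupp a] = map f (mword a).
  rewrite map_flatten -map_comp; congr flatten.
  by apply: eq_map => k; rewrite /= map_nseq.
by rewrite (nth_map 0%N)// size_mword an.
Qed.

(* The real integral is only known on powers of the members of a single orthonormal
   sequence: u and v are merged into one. *)
Definition interleave (T : Type) (u v : nat -> T) (k : nat) : T :=
  if odd k then v k./2 else u k./2.

Lemma interleave_double (T : Type) (u v : nat -> T) k : interleave u v k.*2 = u k.
Proof. by rewrite /interleave odd_double doubleK. Qed.

Lemma interleave_doubleS (T : Type) (u v : nat -> T) k : interleave u v k.*2.+1 = v k.
Proof. by rewrite /interleave /= odd_double /= uphalf_double. Qed.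

Definition minterleave a b : multiindex :=
  [fsfun k in ([fset i.*2 | i in finsupp a] `|`
               [fset i.*2.+1 | i in finsupp b])%fset => interleave a b k].

Lemma minterleaveE a b k : minterleave a b k = interleave a b k.
Proof.
rewrite fsfunE inE; case: ifPn => // /norP[/imfsetP ka /imfsetP kb].
apply/esym/eqP/negP; rewrite /interleave => /negP; case: ifPn => kodd k0.
  apply: kb; exists k./2; rewrite /= ?mem_finsupp//.
  by rewrite -[LHS]odd_double_half kodd.
apply: ka; exists k./2; rewrite /= ?mem_finsupp//.
by rewrite -[LHS]odd_double_half (negPf kodd).
Qed.

(** The pairs 2k, 2k+1 with k in the support of a + b cover the support of the interleaving, but one
    member of a pair may lie outside it; there the exponent is 0 and [F] has to be neutral. *)
Lemma big_minterleave (T : Type) (idx : T) (op : Monoid.com_law idx)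
    (F : nat -> T) a b :
  (forall k, minterleave a b k = 0%N -> F k = idx) ->
  \big[op/idx]_(k <- finsupp (minterleave a b)) F k =
  \big[op/idx]_(k <- finsupp (madd a b)) op (F k.*2) (F k.*2.+1).
Proof.
move=> F0; pose S := finsupp (madd a b).
have -> : \big[op/idx]_(k <- finsupp (minterleave a b)) F k =
    \big[op/idx]_(k <- flatten [seq [:: k.*2; k.*2.+1] | k <- S]) F k.
  rewrite [RHS](bigID (mem (finsupp (minterleave a b))))/=.
  rewrite [X in op _ X]big1 ?Monoid.mulm1 => [|k]; last first.
    by rewrite mem_finsupp negbK => /eqP; exact: F0.
  rewrite -[RHS]big_filter; apply: perm_big; apply: uniq_perm.
  - exact: fset_uniq.
  - apply: filter_uniq; elim: (S : seq nat) (fset_uniq S) => //= k s IH /andP[ks us].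
    have notin i : i./2 = k -> i \notin flatten [seq [:: k.*2; k.*2.+1] | k <- s].
      move=> ik; apply/flatten_mapP => -[x xs]; rewrite !inE.
      by case/orP => /eqP ix; move: ks; rewrite -ik ix /= ?doubleK ?uphalf_double xs.
    rewrite inE negb_or !notin ?IH//= ?doubleK ?uphalf_double//.
    by rewrite andbT neq_ltn ltnSn.
  - move=> k; rewrite mem_filter /=; case: (boolP (k \in finsupp _)) => //= kM.
    apply/esym/flatten_mapP; exists k./2; last first.
      rewrite !inE; have := odd_double_half k.
      by case: (odd k) => /= ek; apply/orP; [right|left]; apply/eqP; rewrite -[LHS]ek.
    move: kM; rewrite /S !mem_finsupp minterleaveE maddE /interleave addn_eq0.
    by case: ifP => _ /negPf ->; rewrite ?andbF.
rewrite big_flatten big_map; apply: eq_bigr => k _.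
by rewrite !big_cons big_nil Monoid.mulm1.
Qed.

Lemma mdeg_minterleave a b : mdeg (minterleave a b) = (mdeg a + mdeg b)%N.
Proof.
rewrite /mdeg big_minterleave//.
have -> : (\sum_(k <- finsupp a) a k + \sum_(k <- finsupp b) b k)%N
    = mdeg (madd a b) by rewrite mdeg_madd.
apply: eq_bigr => k _.
by rewrite !minterleaveE interleave_double interleave_doubleS maddE.
Qed.

Definition mword2 a b : seq nat :=
  flatten [seq nseq (a k) k.*2 ++ nseq (b k) k.*2.+1 | k <- finsupp (madd a b)].

(** The enumeration orders of the two supports need not match, so the words are compared by letter
    counts; that is enough under [symm]. *)
Lemma perm_mword2 a b : perm_eq (mword2 a b) (mword (minterleave a b)).
Proof.
apply/allP => k _ /=; rewrite count_mword minterleaveE.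
have count2 : count_mem k (mword2 a b) =
    (\sum_(i <- finsupp (madd a b))
      ((i.*2 == k) * a i + (i.*2.+1 == k) * b i))%N.
  rewrite /mword2 count_flatten sumnE !big_map; apply: eq_bigr => i _.
  by rewrite count_cat !count_nseq.
rewrite count2.
have [kab|kab] := boolP (k./2 \in finsupp (madd a b)); last first.
  move: kab; rewrite mem_finsupp maddE negbK addn_eq0 => /andP[/eqP ak /eqP bk].
  rewrite /interleave ak bk if_same big1_seq// => i /andP[_].
  rewrite mem_finsupp maddE => ni; apply/eqP; rewrite addn_eq0 !muln_eq0 !eqb0.
  apply/andP; split; apply/orP; case: eqP => ik; try by left.
    by right; move: ak; rewrite -ik doubleK => ->.
  by right; move: bk; rewrite -ik /= uphalf_double => ->.
rewrite (big_fsetD1 k./2)//= big1_seq ?addn0 => [|i]; last first.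
  rewrite !inE => /andP[_ /andP[ik _]]; apply/eqP; rewrite addn_eq0 !muln_eq0 !eqb0.
  apply/andP; split; apply/orP; left; apply: contra ik => /eqP <-.
    by rewrite doubleK.
  by rewrite /= uphalf_double.
have ek := odd_double_half k.
have -> : (k./2.*2 == k) = ~~ odd k by case: (odd k) ek => /=; lia.
have -> : (k./2.*2.+1 == k) = odd k by case: (odd k) ek => /=; lia.
by rewrite /interleave; case: (odd k); rewrite /= ?mul1n ?mul0n ?addn0.
Qed.

Lemma mpower2E (V : zmodType) (u v : nat -> V) a b n (i : 'I_n) :
  (mdeg a + mdeg b)%N = n ->
  mpower2 u v a b i = interleave u v (nth 0%N (mword2 a b) i).
Proof.
move=> abn; rewrite /mpower2.
have -> : flatten [seq nseq (a k) (u k) ++ nseq (b k) (v k)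
    | k <- finsupp (madd a b)] = map (interleave u v) (mword2 a b).
  rewrite map_flatten -map_comp; congr flatten; apply: eq_map => k /=.
  by rewrite map_cat !map_nseq interleave_double interleave_doubleS.
rewrite (nth_map 0%N)// (perm_size (perm_mword2 a b)) size_mword.
by rewrite mdeg_minterleave abn.
Qed.

Lemma perm_eq_nth n (s t : seq nat) : perm_eq s t -> size t = n ->
  exists p : 'S_n, forall i : 'I_n, nth 0%N s i = nth 0%N t (p i).
Proof.
move=> st tn; have tn' : size t == n by rewrite tn.
have : perm_eq s (Tuple tn') by [].
move=> /tuple_permP[p ->]; exists p => i.
rewrite (nth_map i) ?size_enum_ord// nth_ord_enum.
by rewrite (tnth_nth 0%N).
Qed.

Lemma perm_eq_nthP n (s t : seq nat) (p q : 'S_n) : size s = n -> size t = n ->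
  (forall i, nth 0%N s (p i) = nth 0%N t (q i)) -> perm_eq s t.
Proof.
move=> sn tn st; have tn' : size t == n by rewrite tn.
have sn' : size s == n by rewrite sn.
change (perm_eq s (Tuple tn')); apply/tuple_permP; exists (p^-1 * q)%g.
change (val (Tuple sn') = [tuple tnth (Tuple tn') ((p^-1 * q)%g i) | i < n]).
congr val; apply: eq_from_tnth => i; rewrite tnth_mktuple !(tnth_nth 0%N)/=.
by rewrite permM -st permKV.
Qed.

Lemma mword_inj (j j' : multiindex) : perm_eq (mword j) (mword j') -> j = j'.
Proof.
by move=> /seq.permP jj'; apply/fsfunP => k; rewrite -!count_mword jj'.
Qed.

Definition multiindex_of_ffun (D : {fset nat}) (N : nat)
  (f : {ffun D -> 'I_N}) : multiindex := [fsfun k : D => nat_of_ord (f k)].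

Lemma multiindex_of_ffunE (D : {fset nat}) N (f : {ffun D -> 'I_N}) (k : D) :
  multiindex_of_ffun f (val k) = f k.
Proof. by rewrite fsfun_ffun valK. Qed.

Lemma multiindex_of_ffun_inj (D : {fset nat}) N :
  injective (@multiindex_of_ffun D N).
Proof.
move=> f g fg; apply/ffunP => k; apply/val_inj.
by rewrite /= -!multiindex_of_ffunE fg.
Qed.

(** Encoding by functions on the support of [P] prepares for exchanging products and sums. That
    exchange wants one codomain for all positions, hence the common bound [mdeg P], refined by
    [family]. *)
Definition mbelow P : seq multiindex :=
  [seq multiindex_of_ffun f | f : {ffun finsupp P -> 'I_(mdeg P).+1} in
    family (fun k : finsupp P => [pred i : 'I_(mdeg P).+1 | (i <= P (val k))%N])].

Lemma mem_mbelow j P : (j \in mbelow P) <-> mle j P.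
Proof.
split=> [/fintype.imageP[f /familyP fP ->] k|jP].
  have [kP|kP] := boolP (k \in finsupp P); last first.
    by rewrite fsfun_ffun insubN.
  by have := fP [`kP]%fset; rewrite inE -multiindex_of_ffunE.
apply/fintype.imageP; exists [ffun k : finsupp P => inord (j (val k))].
  apply/familyP => k; rewrite ffunE inE inordK ?ltnS// ?jP//.
  exact: leq_trans (jP _) (leq_mdeg_coord _ _).
apply/fsfunP => k; have [kP|kP] := boolP (k \in finsupp P).
  rewrite -[k in RHS]/(val [`kP]%fset) multiindex_of_ffunE ffunE inordK//.
  exact: leq_trans (jP _) (leq_mdeg_coord _ _).
rewrite fsfun_ffun insubN//= fsfun_dflt//.
by apply: contra kP => /(fsubsetP (mle_finsupp jP)).
Qed.

Lemma uniq_mbelow P : uniq (mbelow P).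
Proof. by rewrite map_inj_uniq ?enum_uniq//; exact: multiindex_of_ffun_inj. Qed.

(** Distributivity; this is what reduces an identity over multi-indices to one identity for each
    index k. *)
Lemma sum_mbelow (K : comNzRingType) P (F : nat -> nat -> K) :
  \sum_(j <- mbelow P) \prod_(k <- finsupp P) F k (j k) =
  \prod_(k <- finsupp P) \sum_(i < (P k).+1) F k i.
Proof.
rewrite big_image [RHS]big_seq_fsetE/=.
under [RHS]eq_bigr => k _.
  rewrite -(big_mkord predT (F (val k))) (big_nat_widen _ _ (mdeg P).+1); last first.
    by rewrite ltnS leq_mdeg_coord.
  rewrite big_mkord.
over.
rewrite bigA_distr_big_dep; apply: eq_big => [f|f _].
  by apply/familyP/familyP => fP k; have := fP k; rewrite inE.
by rewrite big_seq_fsetE/=; apply: eq_bigr => k _; rewrite multiindex_of_ffunE.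
Qed.

(** The count is the product of the P_k + 1, and each factor is at most 2^(P_k). *)
Lemma size_mbelow P : (size (mbelow P) <= 2 ^ mdeg P)%N.
Proof.
(* [sum_mbelow] is stated over a ring, hence the detour through the integers; it is applied with all
   factors equal to 1. *)
have sizeE : (size (mbelow P))%:R = (\prod_(k <- finsupp P) (P k).+1)%:R :> int.
  rewrite natr_prod -sum1_size natr_sum.
  transitivity (\sum_(j <- mbelow P) \prod_(k <- finsupp P) (1 : int)).
    by apply: eq_bigr => j _; apply/esym; apply: big1.
  rewrite (@sum_mbelow int P (fun _ _ => 1)); apply: eq_bigr => k _.
  by rewrite sumr_const card_ord.
move/eqP: sizeE; rewrite eqr_nat => /eqP ->.
rewrite /mdeg expn_sum; apply: leq_prod => k _; exact: ltn_expl.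
Qed.

End Multiindex.

(** * Symmetric tensors *)

Section JoinOrd.
Context (K : numFieldType) (V : lmodType K) (a b : nat) (x : 'I_a -> V) (y : 'I_b -> V).

Lemma join_ord_lshift i : join_ord x y (lshift b i) = x i.
Proof. by rewrite /join_ord -[lshift b i]/(unsplit (inl i)) unsplitK. Qed.

Lemma join_ord_rshift i : join_ord x y (rshift a i) = y i.
Proof. by rewrite /join_ord -[rshift a i]/(unsplit (inr i)) unsplitK. Qed.

End JoinOrd.

Section TensorPower.
Context (K : numFieldType) (V : lmodType K) (dotV : V -> V -> K).
Context (T : normedModType K) (dotT : T -> T -> K).

Lemma tensor_ext n (tens : ('I_n -> V) -> T) x y : x =1 y -> tens x = tens y.
Proof. by move=> /funext ->. Qed.

Lemma tensor_scale n (tens : ('I_n -> V) -> T) (a : K) (x : 'I_n -> V) :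
  hilbert_tensor_power dotV dotT tens ->
  tens (fun i => a *: x i) = a ^+ n *: tens x.
Proof.
move=> tensT.
have tens0 (y : 'I_n -> V) i : tens (dfwith y i 0) = 0.
  have := tensor_multilinear tensT y i 1 0 0.
  by rewrite !scale1r addr0 => /esym/eqP; rewrite -subr_eq0 addrK => /eqP.
(* Multilinearity changes one factor at a time: induction on the number k of rescaled factors. *)
suff partial k : (k <= n)%N ->
    tens (fun i : 'I_n => if (i < k)%N then a *: x i else x i) = a ^+ k *: tens x.
  by rewrite -partial//; apply: tensor_ext => i; rewrite ltn_ord.
elim: k => [_|k IH kn]; first by rewrite scale1r; exact: tensor_ext.
pose y (i : 'I_n) := if (i < k)%N then a *: x i else x i.
pose ik := Ordinal kn.
have -> : tens (fun i : 'I_n => if (i < k.+1)%N then a *: x i else x i) =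
    tens (dfwith y ik (a *: x ik + 0)).
  apply: tensor_ext => i; case: dfwithP => [|j]; first by rewrite ltnSn addr0.
  by rewrite /y -val_eqE/= ltnS leq_eqVlt eq_sym => /negPf ->.
rewrite (tensor_multilinear tensT y ik a (x ik) 0) (tens0 y ik) addr0 exprS.
rewrite -scalerA -(IH (ltnW kn)).
congr (_ *: _); apply: tensor_ext => i; case: dfwithP => [|//].
by rewrite ltnn.
Qed.

Lemma symm_perm n (tens : ('I_n -> V) -> T) (x y : 'I_n -> V) (p : 'S_n) :
  (forall i, x i = y (p i)) -> symm tens x = symm tens y.
Proof.
move=> xy; rewrite /symm; congr (_ *: _).
rewrite [RHS](reindex_inj (mulIg p))/=; apply: eq_bigr => s _.
by apply: tensor_ext => i; rewrite xy permM.
Qed.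

Lemma symm_symm_ext a b (tens : ('I_(a + b) -> V) -> T) x x' y y' :
  x =1 x' -> y =1 y' -> symm_symm tens x y = symm_symm tens x' y'.
Proof. by move=> /funext -> /funext ->. Qed.

Lemma symm_symm_scale a b (tens : ('I_(a + b) -> V) -> T) (r : K) x y :
  hilbert_tensor_power dotV dotT tens ->
  symm_symm tens (fun i => r *: x i) (fun i => r *: y i) =
  r ^+ (a + b) *: symm_symm tens x y.
Proof.
move=> tensT; rewrite /symm_symm [RHS]scalerA mulrC -scalerA; congr (_ *: _).
rewrite scaler_sumr; apply: eq_bigr => s _.
rewrite scaler_sumr; apply: eq_bigr => t _.
rewrite -(tensor_scale _ _ tensT); apply: tensor_ext => i.
by rewrite /join_ord; case: fintype.split.
Qed.

End TensorPower.

Section TensorDot.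
Context (R : realType) (V : lmodType R[i]) (dotV : V -> V -> R[i]).
Context (T : normedModType R[i]) (dotT : {dot T for @Num.conj R[i]}).
Context (a b : nat) (tens : ('I_(a + b) -> V) -> T).
Hypothesis (tensT : hilbert_tensor_power dotV dotT tens).

Lemma symm_symm_dot (x : 'I_a -> V) (y : 'I_b -> V) (x' : 'I_a -> V)
    (y' : 'I_b -> V) :
  dotT (symm_symm tens x y) (symm_symm tens x' y') =
  (a`! * b`!)%:R^-1 ^+ 2 *
    \sum_(s : 'S_a) \sum_(t : 'S_b) \sum_(s' : 'S_a) \sum_(t' : 'S_b)
      (\prod_(i < a) dotV (x (s i)) (x' (s' i))) *
      (\prod_(i < b) dotV (y (t i)) (y' (t' i))).
Proof.
rewrite /symm_symm linearZl_LR linearZr_LR mulrA.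
have -> : Num.conj ((a`! * b`!)%:R^-1 : R[i]) = (a`! * b`!)%:R^-1.
  by rewrite fmorphV rmorph_nat.
congr (_ * _).
rewrite linear_sumlz; apply: eq_bigr => s _.
rewrite linear_sumlz; apply: eq_bigr => t _.
rewrite linear_sumr; apply: eq_bigr => s' _.
rewrite linear_sumr; apply: eq_bigr => t' _.
etransitivity; first exact: (tensor_dot tensT).
rewrite big_split_ord/=; congr (_ * _); apply: eq_bigr => i _.
  by rewrite !join_ord_lshift.
by rewrite !join_ord_rshift.
Qed.

Context (e f : nat -> V).
Hypothesis (dot_e : forall j k, dotV (e j) (e k) = if j == k then 2 else 0).
Hypothesis (dot_f : forall j k, dotV (f j) (f k) = if j == k then 2 else 0).

(** A nonzero product forces all paired letters to agree; the two words are then permutations of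
    each other and the multi-indices coincide. *)
Lemma prod_dot_mpower_eq0 n (g : nat -> V) (j j' : multiindex) (s s' : 'S_n) :
  (forall i k, dotV (g i) (g k) = if i == k then 2 else 0) ->
  mdeg j = n -> mdeg j' = n -> j != j' ->
  \prod_(i < n) dotV (mpower g j (s i)) (mpower g j' (s' i)) = 0.
Proof.
move=> dot_g jn jn' jj'; apply/eqP; apply: contraNT jj' => /prodf_neq0 P0.
apply/eqP/mword_inj/(@perm_eq_nthP n _ _ s s'); rewrite ?size_mword// => i.
have := P0 i isT; rewrite !mpowerE// dot_g.
by case: ifP => [/eqP|_]; rewrite ?eqxx.
Qed.

Lemma norm_prod_dot n (x y : 'I_n -> V) :
  (forall i, `|dotV (x i) (y i)| <= 2) ->
  `|\prod_(i < n) dotV (x i) (y i)| <= 2 ^+ n.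
Proof.
move=> xy; rewrite normr_prod.
have -> : 2 ^+ n = \prod_(i < n) (2 : R[i]) by rewrite prodr_const card_ord.
by apply: ler_prod => i _; rewrite normr_ge0/=.
Qed.

Definition symm_symm_power (j k : multiindex) : T :=
  symm_symm tens (@mpower _ e j a) (@mpower _ f k b).

Lemma symm_symm_power_orth (j k j' k' : multiindex) :
  mdeg j = a -> mdeg j' = a -> mdeg k = b -> mdeg k' = b ->
  (j, k) != (j', k') ->
  dotT (symm_symm_power j k) (symm_symm_power j' k') = 0.
Proof.
move=> ja ja' kb kb'; rewrite xpair_eqE negb_and => jk.
rewrite symm_symm_dot big1 ?mulr0// => s _; rewrite big1// => t _.
rewrite big1// => s' _; rewrite big1// => t' _.
case/orP: jk => jk; first by rewrite prod_dot_mpower_eq0 ?mul0r.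
by rewrite mulrC prod_dot_mpower_eq0 ?mul0r.
Qed.

(** The quadruple sum has (a! b!)^2 terms, each of modulus at most 2^a 2^b because the inner
    products involved are 0 or 2; the normalization cancels the number of terms. *)
Lemma symm_symm_power_dot (j k j' k' : multiindex) :
  mdeg j = a -> mdeg j' = a -> mdeg k = b -> mdeg k' = b ->
  `|dotT (symm_symm_power j k) (symm_symm_power j' k')| <= 2 ^+ (a + b).
Proof.
move=> ja ja' kb kb'; rewrite symm_symm_dot normrM.
have le2 (x y : nat) : `|if x == y then 2 else 0 : R[i]| <= 2.
  by case: ifP => _; rewrite ?normr0 ?ler0n// ger0_norm ?ler0n.
have fact0 : (a`! * b`!)%:R != 0 :> R[i].
  by rewrite pnatr_eq0 muln_eq0 negb_or -!lt0n !fact_gt0.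
rewrite ger0_norm ?exprn_ge0 ?invr_ge0 ?ler0n//.
rewrite exprVn ler_pdivrMl ?exprn_gt0 ?ltr0n ?muln_gt0 ?fact_gt0//.
have -> : (a`! * b`!)%:R ^+ 2 * 2 ^+ (a + b) =
    \sum_(s : 'S_a) \sum_(t : 'S_b) \sum_(s' : 'S_a) \sum_(t' : 'S_b)
      (2 ^+ a * 2 ^+ b) :> R[i].
  have sumc (X : finType) (u : R[i]) : \sum_(x : X) u = #|X|%:R * u.
    by rewrite sumr_const mulr_natl.
  rewrite !sumc !card_Sn exprD natrM.
  by move: (2 ^+ a) (2 ^+ b) => u v; ring.
apply: (le_trans (ler_norm_sum _ _ _)); apply: ler_sum => s _.
apply: (le_trans (ler_norm_sum _ _ _)); apply: ler_sum => t _.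
apply: (le_trans (ler_norm_sum _ _ _)); apply: ler_sum => s' _.
apply: (le_trans (ler_norm_sum _ _ _)); apply: ler_sum => t' _.
rewrite normrM ler_pM// norm_prod_dot// => i.
  by rewrite !mpowerE// dot_e.
by rewrite !mpowerE// dot_f.
Qed.

End TensorDot.

(** * Convergence of the kernel series *)

(** A finite set whose partial sum comes within eps of the supremum leaves less than eps to any
    finite set disjoint from it. *)
Lemma esum_tail (R : realType) (I : choiceType) (A : set I) (u : I -> R) :
  (forall i, 0 <= u i) -> (\esum_(i in A) (u i)%:E < +oo)%E ->
  forall eps, 0 < eps -> exists X : {fset I}, forall s : seq I, uniq s ->
    (forall i, i \in s -> A i /\ i \notin X) -> \sum_(i <- s) u i < eps.
Proof.
move=> u0 uoo eps eps0.
have ufin : (\esum_(i in A) (u i)%:E)%E \is a fin_num.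
  rewrite ge0_fin_numE//; apply: esum_ge0 => i _; rewrite lee_fin; exact: u0.
have [_ [F [finF FA] <-]] := ub_ereal_sup_adherent eps0 ufin.
set M := ereal_sup _ => MF; exists (fset_set F) => s us sA.
have uFs : uniq (fset_set F ++ s).
  rewrite cat_uniq us fset_uniq andbT/=; apply/hasPn => i /sA[_].
  by [].
have : ((\sum_(i <- fset_set F ++ s) u i)%:E <= M)%E.
  rewrite -sumEFin fsbig_seq//; apply: ereal_sup_ubound; exists [set` fset_set F ++ s] => //.
  split=> //; move=> i /=; rewrite mem_cat => /orP[|/sA[]//].
  by rewrite in_fset_set// inE; exact: FA.
move: MF; rewrite fsbig_finite// sumEFin.
rewrite big_cat/= EFinD => MF FsM.
have Mfin : M \is a fin_num by exact: ufin.
move: MF FsM; rewrite -(fineK Mfin) -EFinB -EFinD lte_fin lee_fin.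
by move=> MF FsM; lra.
Qed.

Section SchurTest.
Context (R : realType) (T : lmodType R[i]) (dotT : {dot T for @Num.conj R[i]}).
Context (I : choiceType) (Q : eqType) (q : I -> Q) (g : I -> T) (C : R[i]).
Context (A : set I) (N : nat).
Hypothesis (C0 : 0 <= C).
Hypothesis (dot_g : forall a b, A a -> A b ->
  `|dotT (g a) (g b)| <= if q a == q b then C else 0).
Hypothesis (fibre_q : forall (s : seq I) b, uniq s ->
  (forall a, a \in s -> A a /\ q a = b) -> (size s <= N)%N).

(* [2 |c_a| |c_b| <= |c_a|^2 + |c_b|^2] for each nonzero entry of the Gram matrix. *)
Lemma schur_test (c : I -> R[i]) (s : seq I) : uniq s ->
  (forall a, a \in s -> A a) ->
  dotT (\sum_(a <- s) c a *: g a) (\sum_(a <- s) c a *: g a) <=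
    C * N%:R * \sum_(a <- s) `|c a| ^+ 2.
Proof.
move=> us sA; set S := \sum_(a <- s) _.
have S0 : 0 <= dotT S S by exact: dnorm_ge0.
rewrite -(ger0_norm S0) /S linear_sumlz.
have count_s b : (count (fun a => q a == b) s <= N)%N.
  rewrite -size_filter; apply: (fibre_q (b := b)); first exact: filter_uniq.
  by move=> a; rewrite mem_filter => /andP[/eqP ? /sA].
apply: (@le_trans _ _ (\sum_(a <- s) \sum_(b <- s)
    (if q b == q a then C * (2^-1 * (`|c a| ^+ 2 + `|c b| ^+ 2)) else 0))).
  apply: (le_trans (ler_norm_sum _ _ _)).
  rewrite big_seq [leRHS]big_seq; apply: ler_sum => a ax.
  rewrite linear_sumr; apply: (le_trans (ler_norm_sum _ _ _)).
  rewrite big_seq [leRHS]big_seq; apply: ler_sum => b bx.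
  rewrite linearZl_LR linearZr_LR/= !normrM norm_conjC.
  have := dot_g (sA _ ax) (sA _ bx); rewrite eq_sym.
  case: eqP => _ gab; last first.
    have -> : `|dotT (g a) (g b)| = 0 by apply/eqP; rewrite eq_le gab normr_ge0.
    by rewrite !mulr0.
  rewrite mulrA mulrC ler_pM ?mulr_ge0//.
  rewrite ler_pdivlMl ?ltr0n// -subr_ge0.
  have -> : `|c a| ^+ 2 + `|c b| ^+ 2 - 2 * (`|c a| * `|c b|)
      = (`|c a| - `|c b|) ^+ 2 by ring.
  by rewrite real_exprn_even_ge0// rpredB ?normr_real.
(* Row bound: for fixed a, only the b in the fibre of a contribute, at most [N] of them. *)
have sumN (f : I -> R[i]) : (forall a, 0 <= f a) ->
    \sum_(a <- s) \sum_(b <- s) (if q b == q a then f a else 0) <=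
    N%:R * \sum_(a <- s) f a.
  move=> f0; rewrite mulr_sumr; apply: ler_sum => a _.
  rewrite -big_mkcond big_const_seq iter_addr_0 -[leLHS]mulr_natl.
  by rewrite ler_wpM2r// ler_nat count_s.
have -> : \sum_(a <- s) \sum_(b <- s)
    (if q b == q a then C * (2^-1 * (`|c a| ^+ 2 + `|c b| ^+ 2)) else 0) =
  \sum_(a <- s) \sum_(b <- s) (if q b == q a then C * (2^-1 * `|c a| ^+ 2) else 0) +
  \sum_(b <- s) \sum_(a <- s) (if q a == q b then C * (2^-1 * `|c b| ^+ 2) else 0).
  rewrite [X in _ = _ + X]exchange_big -big_split/=; apply: eq_bigr => a _.
  rewrite -big_split/=; apply: eq_bigr => b _; rewrite [q a == q b]eq_sym.
  by case: ifP => _; rewrite ?addr0// -!mulrDr.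
have f0 a : 0 <= C * (2^-1 * `|c a| ^+ 2) by rewrite !mulr_ge0// invr_ge0 ler0n.
apply: (le_trans (lerD (sumN _ f0) (sumN _ f0))).
rewrite -mulrDr -big_split/= !mulr_sumr; apply: ler_sum => a _.
rewrite le_eqVlt; apply/orP; left; apply/eqP.
by move: (`|c a| ^+ 2) => u; field.
Qed.

End SchurTest.

Lemma normcR (R : realType) (z : R[i]) : `|z| = (Normc.normc z)%:C.
Proof. by case: z. Qed.

Lemma partial_sumE (I : choiceType) (V : zmodType) (f : I -> V) (X : {fset I}) :
  partial_sum f X = \sum_(i <- X) f i.
Proof. by rewrite big_seq_fsetE. Qed.

Lemma partial_sum_patch (I : choiceType) (V : zmodType) (A : set I)
    (f : I -> V) (X : {fset I}) :
  partial_sum (patch (fun=> 0) A f) X = \sum_(i <- X | i \in A) f i.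
Proof. by rewrite partial_sumE -big_mkcond. Qed.

Lemma big_fset_subset (V : nmodType) (I : choiceType) (X Y : {fset I})
    (P : pred I) (F : I -> V) : (X `<=` Y)%fset ->
  \sum_(i <- Y | P i) F i =
  \sum_(i <- X | P i) F i + \sum_(i <- (Y `\` X)%fset | P i) F i.
Proof.
move=> XY; rewrite -big_cat; apply: perm_big; apply: uniq_perm.
- exact: fset_uniq.
- rewrite cat_uniq !fset_uniq andbT/=; apply/hasPn => i.
  by rewrite in_fsetD => /andP[].
- move=> i; rewrite mem_cat in_fsetD; case: (boolP (i \in X)) => //=.
  exact: (fsubsetP XY).
Qed.

Section OrthogonalFibres.
Context (R : realType) (T : completeNormedModType R[i]).
Context (dotT : {dot T for @Num.conj R[i]}) (HT : hilbert_dot dotT).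
Context (I : choiceType) (Q : eqType) (q : I -> Q) (g : I -> T) (C : R[i]).
Context (A : set I) (N : nat).
Hypothesis (C0 : 0 <= C).
Hypothesis (dot_g : forall a b, A a -> A b ->
  `|dotT (g a) (g b)| <= if q a == q b then C else 0).
Hypothesis (fibre_q : forall (s : seq I) b, uniq s ->
  (forall a, a \in s -> A a /\ q a = b) -> (size s <= N)%N).

(** By the Schur test, the squared norm of a finite sum outside [X] is at most C N times a tail of
    the sum of |c_a|^2, so the partial sums are Cauchy along the finite sets. *)
Lemma cvg_orthogonal_fibres (c : I -> R[i]) :
  (\esum_(a in A) (Normc.normc (c a) ^+ 2)%:E < +oo)%E ->
  cvg (partial_sum (patch (fun=> 0) A (fun a => c a *: g a)) @ totally).
Proof.
move=> csum; set S := partial_sum _.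
have SF : ProperFilter (S @ totally) := fmap_proper_filter _ totally_filter.
apply/cauchy_cvgP/cauchy_exP => eps eps0.
case/complex_realP: (gtr0_real eps0) => r epsE.
case/complex_realP: (ger0_real C0) => K CE.
have r0 : 0 < r by rewrite -ltcR -epsE.
have K0 : 0 <= K by rewrite -lecR -CE.
(* Chosen so that K N delta < r^2; the + 1 keeps the denominator positive when K N = 0. *)
pose delta := r ^+ 2 / (K * N%:R + 1).
have delta0 : 0 < delta.
  by rewrite divr_gt0 ?exprn_gt0// ltr_wpDl ?mulr_ge0// ler0n.
have [X Xtail] := esum_tail (fun i => sqr_ge0 _) csum delta0.
exists (S X), X => // Y /= XY; rewrite -ball_normE /=.
rewrite /S !partial_sum_patch.
pose s := [seq i <- (Y `\` X)%fset | i \in A].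
have -> : \sum_(i <- X | i \in A) c i *: g i - \sum_(i <- Y | i \in A) c i *: g i
    = - \sum_(i <- s) c i *: g i.
  by rewrite big_filter (big_fset_subset _ _ XY) opprD addNKr.
rewrite normrN -(@ltr_pXn2r _ 2)// ?nnegrE// ?(ltW eps0)// -HT.
have us : uniq s by rewrite filter_uniq.
have sA i : i \in s -> A i /\ i \notin X.
  by rewrite mem_filter !inE => /andP[/set_mem ? /andP[? _]].
apply: (le_lt_trans (schur_test C0 dot_g fibre_q c us (fun i si => (sA i si).1))).
have -> : \sum_(a <- s) `|c a| ^+ 2 = (\sum_(a <- s) Normc.normc (c a) ^+ 2)%:C.
  by rewrite rmorph_sum; apply: eq_bigr => i _; rewrite normcR -rmorphXn.
have := Xtail s us sA; rewrite CE epsE.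
move: (\sum_(a <- s) _) => v vdelta.
rewrite -rmorphXn -[N%:R](rmorph_nat (real_complex R)) -!rmorphM/= ltcR.
apply: le_lt_trans (_ : K * N%:R * delta < _).
  by rewrite ler_wpM2l ?mulr_ge0// ltW.
rewrite /delta mulrA ltr_pdivrMr; last by rewrite ltr_wpDl ?mulr_ge0// ler0n.
by rewrite [ltRHS]mulrC ltr_pM2r ?exprn_gt0// ltrDl.
Qed.

End OrthogonalFibres.

(** * Closed linear spans *)

Section ClosedSpan.
Context (K : numFieldType) (T : normedModType K) (B : set T).

Lemma lspan0 : lspan B 0.
Proof.
exists 0%N, (fun=> 0), (fun=> 0); split; first by case.
by rewrite big_ord0.
Qed.

Lemma lspan_id x : B x -> lspan B x.
Proof.
move=> Bx; exists 1%N, (fun=> 1), (fun=> x); split=> //.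
by rewrite big_ord1 scale1r.
Qed.

Lemma lspan_linear (a : K) x y : lspan B x -> lspan B y -> lspan B (a *: x + y).
Proof.
move=> [n [c [f [Bf ->]]]] [m [d [h [Bh ->]]]].
exists (n + m)%N, (fun i => match fintype.split i with inl j => a * c j | inr j => d j end).
exists (join_ord f h); split.
  by move=> i; rewrite /join_ord; case: fintype.split.
rewrite big_split_ord/= scaler_sumr; congr (_ + _); apply: eq_bigr => i _.
  by rewrite join_ord_lshift -[lshift m i]/(unsplit (inl i)) unsplitK scalerA.
by rewrite join_ord_rshift -[rshift n i]/(unsplit (inr i)) unsplitK.
Qed.

Lemma lspan_sum (I : Type) (s : seq I) (P : pred I) (c : I -> K) (f : I -> T) :
  (forall i, P i -> lspan B (f i)) -> lspan B (\sum_(i <- s | P i) c i *: f i).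
Proof.
move=> Bf; elim/big_rec: _ => [|i x Pi Bx]; first exact: lspan0.
by apply: lspan_linear => //; exact: Bf.
Qed.

Lemma cvg_closure (U : Type) (F : set_system U) {FF : ProperFilter F}
    (S : set T) (f : U -> T) l :
  (forall x, S (f x)) -> f @ F --> l -> closure S l.
Proof.
move=> Sf fl V /fl FV; have [x Vx] := @filter_ex _ F FF _ FV.
by exists (f x).
Qed.

Lemma closure_lspan_linear (a : K) x y :
  closure (lspan B) x -> closure (lspan B) y -> closure (lspan B) (a *: x + y).
Proof.
move=> Bx By V /= Vxy.
have lin : (fun z : T * T => a *: z.1 + z.2) @ (x, y) --> a *: x + y.
  apply: cvgD; last exact: cvg_snd.
  by apply: cvgZ; [exact: cvg_cst|exact: cvg_fst].
have [[V1 V2] [V1x V2y] V12] := lin _ Vxy.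
have [x' [Bx' V1x']] := Bx _ V1x; have [y' [By' V2y']] := By _ V2y.
exists (a *: x' + y'); split; first exact: lspan_linear.
exact: (V12 (x', y')).
Qed.

Lemma closure_lspan_sub x : lspan B x -> closure (lspan B) x.
Proof. exact: subset_closure. Qed.

End ClosedSpan.

Lemma sum_bin_leq m j : (\sum_(r < j) 'C(m, r) <= 2 ^ m)%N.
Proof.
have -> : (2 ^ m = \sum_(r < m.+1) 'C(m, r))%N.
  by rewrite -[2%N]/(1 + 1)%N expnDn; apply: eq_bigr => i _; rewrite !exp1n !muln1.
rewrite -!(big_mkord predT (fun r => 'C(m, r))).
have [jm|mj] := leqP j m.+1.
  by rewrite [leqRHS](@big_cat_nat _ _ _ j)//= leq_addr.
rewrite [leqLHS](@big_cat_nat _ _ _ m.+1) ?(ltnW mj)//= [X in (_ + X)%N]big_nat.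
by rewrite [X in (_ + X)%N]big1 ?addn0// => r /andP[mr _]; rewrite bin_small.
Qed.

Lemma atildeE (R : realType) (m n : multiindex) k j :
  atilde R m n k j = hermite_coef R (m k) (n k) j.
Proof. by rewrite /atilde maddE. Qed.

(** The sum over r + s = j is dominated by the product of the full sums of C(m,r) and of C(n,s), at
    most 2^m 2^n, which is the denominator. *)
Lemma norm_hermite_coef (R : realType) m n j : `|hermite_coef R m n j| <= 1.
Proof.
rewrite normrM normrM normrX normCi expr1n mul1r.
rewrite ger0_norm ?invr_ge0 ?exprn_ge0 ?ler0n//.
rewrite ler_pdivrMl ?exprn_gt0 ?ltr0n// mulr1 exprD -!natrX -natrM.
apply: (@le_trans _ _ (\sum_(r < j.+1) \sum_(s < j.+1) ('C(m, r) * 'C(n, s))%:R)).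
  apply: (le_trans (ler_norm_sum _ _ _)); apply: ler_sum => r _.
  apply: (le_trans (ler_norm_sum _ _ _)); rewrite big_mkcond/=; apply: ler_sum => s _.
  case: ifP => _; last exact: ler0n.
  by rewrite normrM normrX normrN1 expr1n mulr1 -natrM normr_nat.
under eq_bigr do rewrite -natr_sum -big_distrr/=.
by rewrite -natr_sum -big_distrl/= ler_nat leq_mul// sum_bin_leq.
Qed.

Section KernelSeries.
Context (R : realType) (H : completeNormedModType R) (dotH : {dot H for @idfun R}).
Context (e : nat -> complexification H).
Hypothesis (orthe : complete_orthogonal (complexification_dot dotH) 2 e).
Context (l q : nat) (T : completeNormedModType R[i]).
Context (dotT : {dot T for @Num.conj R[i]}) (HT : hilbert_dot dotT).
Context (tens : ('I_(l + q) -> complexification H) -> T).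
Hypothesis (tensT : hilbert_tensor_power (complexification_dot dotH) dotT tens).

Let ebar k := complexification_conj (e k).

(** Conjugation conjugates the inner products, and those of the e_k are real. *)
Lemma conj_dot j k :
  complexification_dot dotH (ebar j) (ebar k) = if j == k then 2 else 0.
Proof.
have -> : complexification_dot dotH (ebar j) (ebar k) =
    conjc (complexification_dot dotH (e j) (e k)).
  rewrite /complexification_dot /ebar /= !linearNl !linearNr opprK.
  by rewrite opprB opprK; congr Complex; rewrite addrC.
by rewrite orthe.1; case: ifP => _; rewrite ?rmorph0 ?rmorph_nat.
Qed.

Lemma kernel_gE m n : kernel_g e tens m n =
  \sum_(j <- mbelow (madd m n) | mdeg j == l)
    (\prod_(k <- finsupp (madd m n)) hermite_coef R (m k) (n k) (j k)) *:
      symm_symm_power tens e ebar j (msub (madd m n) j).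
Proof.
rewrite -[RHS]big_filter /kernel_g [RHS]fsbig_seq ?filter_uniq ?uniq_mbelow//.
have -> : [set j | mle j (madd m n) /\ mdeg j = l] =
    [set` [seq j <- mbelow (madd m n) | mdeg j == l]].
  apply/seteqP; split=> j /=; rewrite mem_filter.
    by move=> [/mem_mbelow -> ->]; rewrite eqxx.
  by move=> /andP[/eqP jl /mem_mbelow].
apply: eq_fsbigr => j _; congr (_ *: _).
by apply: eq_bigr => k _; rewrite atildeE.
Qed.

Let A := [set mn : multiindex * multiindex | (mdeg mn.1 + mdeg mn.2)%N = (l + q)%N].
Let g (mn : multiindex * multiindex) := kernel_g e tens mn.1 mn.2.

(** The pair (j, P - j) determines P = m + n, so kernels with different sums are built on orthogonal
    tensors. For equal sums, the coefficients have modulus at most 1, there are at most 2^(l+q)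
    indices j and as many j', and each inner product has modulus at most 2^(l+q): hence 8 = 2^3. *)
Lemma kernel_g_dot a b : A a -> A b ->
  `|dotT (g a) (g b)| <=
    if madd a.1 a.2 == madd b.1 b.2 then 8 ^+ (l + q) else 0.
Proof.
case: a b => [m n] [m' n'] /= mnA mnA'; rewrite /g /= !kernel_gE.
rewrite linear_sumlz.
have degq M N j : (mdeg M + mdeg N)%N = (l + q)%N -> mle j (madd M N) ->
    mdeg j = l -> mdeg (msub (madd M N) j) = q.
  by move=> MN jMN jl; rewrite mdeg_msub// mdeg_madd MN jl addKn.
have norm_coef M N (j : multiindex) : `|\prod_(k <- finsupp (madd M N))
    hermite_coef R (M k) (N k) (j k)| <= 1.
  rewrite normr_prod.
  apply: (@le_trans _ _ (\prod_(k <- finsupp (madd M N)) 1)); last by rewrite big1.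
  by apply: ler_prod => k _; rewrite normr_ge0 norm_hermite_coef.
case: eqP => PP; last first.
  rewrite big_seq_cond big1 ?normr0// => j /andP[/mem_mbelow jP /eqP jl].
  rewrite linear_sumr big_seq_cond big1// => j' /andP[/mem_mbelow jP' /eqP jl'].
  rewrite linearZl_LR linearZr_LR/= (symm_symm_power_orth tensT orthe.1 conj_dot) ?mulr0//;
    try exact: degq.
  apply: contra_notN PP => /eqP[jj kk].
  by have := msubK jP; rewrite kk jj (msubK jP').
have sizeP M N : (mdeg M + mdeg N)%N = (l + q)%N ->
    \sum_(j <- mbelow (madd M N)) (1 : R[i]) <= 2 ^+ (l + q).
  move=> MN; rewrite big_const_seq count_predT iter_addr_0 -natrX ler_nat.
  by rewrite -MN -mdeg_madd size_mbelow.
apply: (@le_trans _ _ (\sum_(j <- mbelow (madd m n)) \sum_(j' <- mbelow (madd m' n'))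
    2 ^+ (l + q))).
  apply: (le_trans (ler_norm_sum _ _ _)).
  rewrite big_mkcond big_seq [leRHS]big_seq; apply: ler_sum => j /mem_mbelow jP.
  case: eqP => jl; last by rewrite sumr_ge0// => ? _; rewrite exprn_ge0 ?ler0n.
  rewrite linear_sumr; apply: (le_trans (ler_norm_sum _ _ _)).
  rewrite big_mkcond big_seq [leRHS]big_seq; apply: ler_sum => j' /mem_mbelow jP'.
  case: eqP => jl'; last by rewrite exprn_ge0 ?ler0n.
  rewrite linearZl_LR linearZr_LR/= !normrM norm_conjC mulrA.
  rewrite -[leRHS]mul1r ler_pM ?mulr_ge0//; last first.
    by apply: (symm_symm_power_dot tensT orthe.1 conj_dot) => //; exact: degq.
  by rewrite mulr_ile1.
have -> : \sum_(j <- mbelow (madd m n)) \sum_(j' <- mbelow (madd m' n')) 2 ^+ (l + q) =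
  (\sum_(j <- mbelow (madd m n)) 1) * ((\sum_(j' <- mbelow (madd m' n')) 1) * 2 ^+ (l + q))
   :> R[i].
  rewrite mulr_suml; apply: eq_bigr => j _; rewrite mul1r mulr_suml.
  by apply: eq_bigr => j' _; rewrite mul1r.
have -> : 8 ^+ (l + q) = 2 ^+ (l + q) * (2 ^+ (l + q) * 2 ^+ (l + q)) :> R[i].
  by rewrite -!exprMn; congr (_ ^+ _); ring.
rewrite ler_pM ?mulr_ge0 ?sumr_ge0 ?exprn_ge0 ?ler0n// ?sizeP//.
by rewrite ler_wpM2r ?sizeP ?exprn_ge0 ?ler0n.
Qed.

(** Once m + n = P is fixed, m determines n and lies below P. *)
Lemma madd_fibre (s : seq (multiindex * multiindex)) (P : multiindex) : uniq s ->
  (forall a, a \in s -> A a /\ madd a.1 a.2 = P) -> (size s <= 2 ^ (l + q))%N.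
Proof.
move=> us sA; case: s us sA => // a s us sA.
have [aA aP] := sA a (mem_head _ _).
rewrite -aA -mdeg_madd aP; apply: leq_trans (size_mbelow P).
rewrite -(size_map fst); apply: uniq_leq_size.
  rewrite map_inj_in_uniq// => -[m n] [m' n'] /sA[_ /= mn] /sA[_ /= mn'] /= mm.
  by rewrite -mm in mn' *; rewrite -(maddK m n) -(maddK m n') mn mn'.
move=> _ /mapP[[m n] /sA[_ /= mn] ->]; apply/mem_mbelow => k.
by rewrite -mn maddE leq_addr.
Qed.

Lemma kernel_g_bisymmetric m n : (mdeg m + mdeg n)%N = (l + q)%N ->
  lspan [set v | exists x y, v = symm_symm tens x y] (kernel_g e tens m n).
Proof.
by move=> mnA; rewrite kernel_gE; apply: lspan_sum => j _; apply: lspan_id;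
  exists (@mpower _ e j l), (@mpower _ ebar (msub (madd m n) j) q).
Qed.

Lemma kernel_series_bisymmetric (c : multiindex * multiindex -> R[i]) X :
  lspan [set v | exists x y, v = symm_symm tens x y]
    (partial_sum (patch (fun=> 0) A (fun mn => c mn *: g mn)) X).
Proof.
rewrite partial_sum_patch; apply: lspan_sum => mn /set_mem mnA.
exact: kernel_g_bisymmetric.
Qed.

Lemma kernel_series_cvg (c : multiindex * multiindex -> R[i]) :
  (\esum_(mn in A) (Normc.normc (c mn) ^+ 2)%:E < +oo)%E ->
  exists2 gt, bisymmetric_power tens gt &
    partial_sum (patch (fun=> 0) A (fun mn => c mn *: g mn)) @ totally --> gt.
Proof.
move=> csum.
have cv := cvg_orthogonal_fibres HT (exprn_ge0 _ (ler0n _ 8)) kernel_g_dot madd_fibre csum.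
exists (lim (partial_sum (patch (fun=> 0) A (fun mn => c mn *: g mn)) @ totally)) => //.
apply: (@cvg_closure _ _ _ _ totally_filter _ _ _ (kernel_series_bisymmetric c) cv).
Qed.

End KernelSeries.

(** * Gaussian processes and multiple integrals *)

Section SecondMoment.
Context d (Omega : measurableType d) (R : realType) (P : probability Omega R).
Implicit Types (f g : Omega -> R).

Local Notation msq f := (\int[P]_w ((f w) ^+ 2)%:E)%E.

Lemma measurable_sq f : measurable_fun setT f ->
  measurable_fun setT (EFin \o (fun w => (f w) ^+ 2)).
Proof. by move=> mf; apply/measurable_EFinP; exact: measurable_funX. Qed.

Lemma ae_eq0_msq f : measurable_fun setT f -> (msq f <= 0)%E ->
  {ae P, forall w, f w = 0}.
Proof.
move=> mf f0.
have abs2 w : `|((f w) ^+ 2)%:E|%E = ((f w) ^+ 2)%:E.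
  by rewrite gee0_abs// lee_fin sqr_ge0.
have := (ae_eq_integral_abs P measurableT (measurable_sq mf)).1.
under eq_integral do rewrite abs2.
have -> : msq f = 0%E.
  by apply/eqP; rewrite eq_le f0 integral_ge0// => w _; rewrite lee_fin sqr_ge0.
move=> /(_ erefl); apply: filterS => w /(_ I) /=.
by move=> /eqP; rewrite eqe sqrf_eq0 => /eqP.
Qed.

Lemma ae_eq_msq f g : measurable_fun setT f -> measurable_fun setT g ->
  {ae P, forall w, f w = g w} -> msq f = msq g.
Proof.
move=> mf mg fg; apply: ge0_ae_eq_integral => //; try exact: measurable_sq.
- by move=> w _; rewrite lee_fin sqr_ge0.
- by move=> w _; rewrite lee_fin sqr_ge0.
by apply: filterS fg => w -> _.
Qed.

(** The inequality (f+g)^2 <= 2 (f^2 + g^2) stands in for the triangle inequality of L^2; the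
    constant is harmless, since all bounds will be made arbitrarily small. *)
Lemma msqD f g (a b : R) : measurable_fun setT f -> measurable_fun setT g ->
  (msq f <= a%:E -> msq g <= b%:E -> msq (f \+ g)%R <= (2 * (a + b))%:E)%E.
Proof.
move=> mf mg fa gb.
apply: (@le_trans _ _ (\int[P]_w (2%:E * (((f w) ^+ 2)%:E + ((g w) ^+ 2)%:E)))%E).
  apply: ge0_le_integral => //.
  - by move=> w _; rewrite lee_fin sqr_ge0.
  - exact/measurable_sq/measurable_funD.
  - apply: measurable_funeM; apply: emeasurable_funD; exact: measurable_sq.
  move=> w _; rewrite -EFinD -EFinM lee_fin /= -subr_ge0.
  have -> : 2 * (f w ^+ 2 + g w ^+ 2) - (f w + g w) ^+ 2 = (f w - g w) ^+ 2 by ring.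
  exact: sqr_ge0.
rewrite ge0_integralZl//; last 2 first.
- by apply: emeasurable_funD; exact: measurable_sq.
- by move=> w _; rewrite -EFinD lee_fin addr_ge0 ?sqr_ge0.
rewrite ge0_integralD//; try exact: measurable_sq; last 2 first.
- by move=> w _; rewrite lee_fin sqr_ge0.
- by move=> w _; rewrite lee_fin sqr_ge0.
by rewrite EFinM (EFinD a b) lee_pmul2l ?lte_fin// leeD.
Qed.

Lemma measurable_fun_sumr (I : Type) (s : seq I) (f : I -> Omega -> R) :
  (forall i, measurable_fun setT (f i)) ->
  measurable_fun setT (fun w => \sum_(i <- s) f i w).
Proof.
move=> mf; elim: s => [|i s IH].
  by under eq_fun do rewrite big_nil; exact: measurable_cst.
by under eq_fun do rewrite big_cons; exact: measurable_funD.
Qed.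

(** Adding one term costs 2 (a + u a) <= 4 u a, where u >= 1 is the power of 4 reached so far. *)
Lemma msq_sum (I : Type) (s : seq I) (f : I -> Omega -> R) (a : R) : 0 <= a ->
  (forall i, measurable_fun setT (f i)) ->
  (forall i, msq (f i) <= a%:E)%E ->
  (msq (fun w => \sum_(i <- s) f i w)%R <= (4 ^+ size s * a)%:E)%E.
Proof.
move=> a0 mf fa; elim: s => [|i s IH].
  under eq_integral do rewrite big_nil expr0n/=.
  by rewrite integral0 lee_fin mulr_ge0.
under eq_integral do rewrite big_cons.
apply: le_trans (msqD (mf i) _ (fa i) IH) _; first exact: measurable_fun_sumr.
rewrite lee_fin exprS -/(size s).
have : 1 <= 4 ^+ size s :> R by rewrite exprn_ege1// ler1n.
by move: (4 ^+ _) => u u1; nra.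
Qed.

Lemma msq_eq0_ae f : measurable_fun setT f ->
  (forall eps, 0 < eps -> (msq f <= eps%:E)%E) -> {ae P, forall w, f w = 0}.
Proof.
move=> mf fe; apply: ae_eq0_msq => //; apply/lee_addgt0Pr => eps e0.
by rewrite add0e fe.
Qed.

End SecondMoment.

Section Isonormal.
Context d (Omega : measurableType d) (R : realType) (P : probability Omega R).
Context (H : lmodType R) (dotH : {dot H for @idfun R}).
Context (X : H -> {RV P >-> R}) (isoX : isonormal dotH X).

(** The covariance gives the squares a finite integral, and |X(h) X(g)| <= X(h)^2 + X(g)^2 takes
    care of the mixed products. *)
Lemma isonormal_integrable h g :
  P.-integrable setT (fun w => (X h w * X g w)%:E).
Proof.
have sq k : P.-integrable setT (fun w => (X k w * X k w)%:E).
  apply/integrableP; split.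
    by apply/measurable_EFinP; apply: measurable_funM.
  have := isoX.2 k k; rewrite unlock => Ek.
  rewrite (eq_integral (fun w => (X k w * X k w)%:E)) ?Ek ?ltry// => w _.
  by rewrite gee0_abs// lee_fin -expr2 sqr_ge0.
apply: (le_integrable measurableT _ _ (integrableD measurableT (sq h) (sq g))).
  by apply/measurable_EFinP; apply: measurable_funM.
move=> w _; rewrite /= lee_fin [leRHS]ger0_norm -?expr2; last first.
  by rewrite addr_ge0 ?sqr_ge0.
rewrite ler_norml; apply/andP; split; nra.
Qed.

(* Linearity of an isonormal process is a consequence of its covariance. *)
Lemma isonormalN h : {ae P, forall w, X (- h) w = - X h w}.
Proof.
have mX k : measurable_fun setT (X k) by [].
suff : {ae P, forall w, X h w + X (- h) w = 0}.
  by apply: filterS => w /eqP; rewrite addrC addr_eq0 => /eqP.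
apply: (ae_eq0_msq (f := fun w => X h w + X (- h) w)).
  exact: measurable_funD.
rewrite (eq_integral (fun w => ((X h w * X h w)%:E + (X (- h) w * X (- h) w)%:E) +
  ((X h w * X (- h) w)%:E + (X h w * X (- h) w)%:E))%E); last first.
  by move=> w _; rewrite -!EFinD; congr (_%:E); ring.
have int h1 h2 := isonormal_integrable h1 h2.
have E h1 h2 : (\int[P]_w (X h1 w * X h2 w)%:E = (dotH h1 h2)%:E)%E.
  by have := isoX.2 h1 h2; rewrite unlock.
rewrite integralD//; [|exact: integrableD|exact: integrableD].
rewrite !integralD// !E -!EFinD lee_fin.
by rewrite !linearNl !linearNr; lra.
Qed.

End Isonormal.

(** * Orthonormal bases built from the e_k *)

Section OrthonormalBases.
Context (R : realType) (H : completeNormedModType R) (dotH : {dot H for @idfun R}).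
Context (e : nat -> complexification H).
Hypothesis (orthe : complete_orthogonal (complexification_dot dotH) 2 e).

Let s : R := (Num.sqrt 2)^-1.

Let ss2 : s * s * 2 = 1.
Proof. by rewrite /s -invfM -expr2 sqr_sqrtr ?ler0n// mulVf ?pnatr_eq0. Qed.

Let s0 : s != 0.
Proof. by rewrite invr_eq0 sqrtr_eq0 -ltNge ltr0n. Qed.

Lemma complexification_scale_real (r : R) (x : complexification H) :
  r%:C *: x = (r *: x.1, r *: x.2).
Proof.
rewrite [LHS]/(complexification_scale r%:C x) /complexification_scale /=.
by rewrite !scale0r subr0 add0r.
Qed.

Let dot_re j k : dotH (e j).1 (e k).1 + dotH (e j).2 (e k).2 =
  if j == k then 2 else 0.
Proof. by have /(congr1 (@complex.Re R)) := orthe.1 j k; case: ifP. Qed.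

Let dot_im j k : dotH (e j).2 (e k).1 - dotH (e j).1 (e k).2 = 0.
Proof.
have /(congr1 (@complex.Im R)) /= -> := orthe.1 j k.
by case: ifP => //= _; rewrite addr0.
Qed.

Let dZ a b (x y : H) : dotH (a *: x) (b *: y) = a * b * dotH x y.
Proof. by rewrite linearZl_LR linearZr_LR mulrA. Qed.

(** Up to sign, the inner products among the u_k and v_k are half the real and imaginary parts of
    those of the e_k. For completeness, if (x1, x2) is orthogonal to all u_k and v_k, then x1 - i x2
    is orthogonal to all e_k, hence 0. *)
Lemma interleave_orthonormal :
  complete_orthonormal (dsum_dot dotH) (interleave (u10 e) (v10 e)).
Proof.
split=> [j k|[x1 x2] xeta].
  have jk : (j == k) = (odd j == odd k) && (j./2 == k./2).
    apply/eqP/andP => [-> //|[/eqP o /eqP h]].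
    by rewrite -[LHS]odd_double_half -[RHS]odd_double_half o h.
  rewrite jk /interleave /dsum_dot; case: (odd j) (odd k) => [] [] /=;
    rewrite !dZ -mulrDr ?linearNl ?linearNr ?opprK.
  - by rewrite addrC dot_re; case: ifP => _; rewrite ?mulr0.
  - by rewrite dot_im mulr0.
  - by rewrite -[X in _ * X]opprB dot_im oppr0 mulr0.
  - by rewrite dot_re; case: ifP => _; rewrite ?mulr0.
have x0 : (x1, - x2) = 0 :> complexification H.
  apply: orthe.2 => k; have := xeta k.*2; have := xeta k.*2.+1.
  rewrite interleave_double interleave_doubleS /dsum_dot /=.
  rewrite !linearZr_LR/= linearNr -!mulrDr => /eqP.
  rewrite mulf_eq0 (negPf s0)/= => /eqP im /eqP.
  rewrite mulf_eq0 (negPf s0)/= => /eqP re.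
  rewrite /complexification_dot /= !linearNl re -opprD addrC.
  by rewrite im oppr0.
by case: x0 => -> /eqP; rewrite oppr_eq0 => /eqP ->.
Qed.

Lemma normalized_orthonormal :
  complete_orthonormal (complexification_dot dotH) (fun k => s%:C *: e k).
Proof.
split=> [j k|x xe].
  rewrite !complexification_scale_real /complexification_dot /=.
  rewrite !dZ -mulrDr -mulrBr dot_re dot_im.
  by rewrite mulr0; case: ifP => _; rewrite ?ss2 ?mulr0.
apply: orthe.2 => k; have := xe k.
rewrite complexification_scale_real /complexification_dot /=.
rewrite !linearZr_LR/= -mulrDr -mulrBr => -[/eqP re /eqP im].
move: re im; rewrite !mulf_eq0 (negPf s0)/= => /eqP -> /eqP ->.
by [].
Qed.

End OrthonormalBases.

Lemma filter_forall_seq (U : Type) (F : set_system U) {FF : Filter F}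
    (I : eqType) (s : seq I) (Q : I -> U -> Prop) :
  (forall i, i \in s -> \forall u \near F, Q i u) ->
  \forall u \near F, forall i, i \in s -> Q i u.
Proof.
elim: s => [|j s IH] Qs; first exact: nearW.
have Qj := Qs j (mem_head _ _).
have := IH (fun i si => Qs i (@mem_behead _ (j :: s) i si)).
by apply: filterS2 Qj => u Qju Qsu i; rewrite inE => /predU1P[->|/Qsu].
Qed.

Section AlmostSureLinearity.
Context d (Omega : measurableType d) (R : realType) (P : probability Omega R).
Context (K : numFieldType) (T : normedModType K) (B : set T).
Context (I : T -> Omega -> K).
Hypothesis linI : forall (a : K) (f g : T),
  closure (lspan B) f -> closure (lspan B) g ->
  {ae P, forall w, I (a *: f + g) w = a * I f w + I g w}.

Lemma ae_linear0 : {ae P, forall w, I 0 w = 0}.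
Proof.
have B0 : closure (lspan B) 0 by exact/closure_lspan_sub/lspan0.
have := linI 1 B0 B0; apply: filterS => w.
by rewrite scale1r addr0 mul1r => /esym/eqP; rewrite -subr_eq0 addrK => /eqP.
Qed.

Lemma ae_linearZ (a : K) f : closure (lspan B) f ->
  {ae P, forall w, I (a *: f) w = a * I f w}.
Proof.
move=> Bf; have B0 : closure (lspan B) 0 by exact/closure_lspan_sub/lspan0.
have h1 := linI a Bf B0; have h2 := ae_linear0.
by near=> w; rewrite -[a *: f]addr0 (near h1 w)// (near h2 w)// addr0.
Unshelve. all: by end_near. Qed.

Lemma ae_linearB f g : closure (lspan B) f -> closure (lspan B) g ->
  {ae P, forall w, I (f - g) w = I f w - I g w}.
Proof.
move=> Bf Bg; have := linI (-1) Bg Bf; apply: filterS => w.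
by rewrite scaleN1r mulN1r addrC [RHS]addrC.
Qed.

(** Each use of linearity holds off its own null set; only finitely many are discarded. *)
Lemma ae_linear_sum (J : Type) (s : seq J) (Q : pred J) (c : J -> K) (f : J -> T) :
  (forall j, Q j -> closure (lspan B) (f j)) ->
  {ae P, forall w, I (\sum_(j <- s | Q j) c j *: f j) w =
     \sum_(j <- s | Q j) c j * I (f j) w}.
Proof.
move=> Bf; have clos s' : closure (lspan B) (\sum_(j <- s' | Q j) c j *: f j).
  elim/big_rec: _ => [|j x Qj Bx]; first exact/closure_lspan_sub/lspan0.
  by apply: closure_lspan_linear => //; exact: Bf.
elim: s => [|j s IH].
  by rewrite big_nil; apply: filterS ae_linear0 => w ->; rewrite big_nil.
rewrite big_cons; case: ifPn => Qj; last first.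
  by apply: filterS IH => w ->; rewrite big_cons (negPf Qj).
have := linI (c j) (Bf j Qj) (clos s).
by apply: filterS2 IH => w; rewrite big_cons Qj => -> ->.
Qed.

End AlmostSureLinearity.

(** * Integrals of basis tensors and of their kernels *)

Section BasisElements.
Context (R : realType) d (Omega : measurableType d) (P : probability Omega R).
Context (H : completeNormedModType R) (dotH : {dot H for @idfun R}).
Context (X Y : H -> {RV P >-> R}) (isoY : isonormal dotH Y).
Context (e : nat -> complexification H).
Hypothesis (orthe : complete_orthogonal (complexification_dot dotH) 2 e).

Let Wu k (w : Omega) : R := process_W X Y (u10 e k) w.
Let Wv k (w : Omega) : R := process_W X Y (v10 e k) w.
Let ebar k := complexification_conj (e k).

Lemma wiener_ito_basis (He : nat -> R -> R) (p : nat) (T : normedModType R)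
    (tens : ('I_p -> (H * H)%type) -> T)
    (I : T -> {RV P >-> R}) (m n : multiindex) :
  hermite_polynomials He ->
  wiener_ito_integral (dsum_dot dotH) (process_W X Y) He tens I ->
  (mdeg m + mdeg n)%N = p ->
  {ae P, forall w, I (symm tens (@mpower2 _ (u10 e) (v10 e) m n p)) w =
    \prod_(k <- finsupp (madd m n)) (He (m k) (Wu k w) * He (n k) (Wv k w))}.
Proof.
move=> heHe intI mnp; pose M := minterleave m n; pose eta := interleave (u10 e) (v10 e).
have Mp : mdeg M = p by rewrite mdeg_minterleave.
have [s ps] : exists s : 'S_p, forall i : 'I_p,
    nth 0%N (mword2 m n) i = nth 0%N (mword M) (s i).
  by apply: perm_eq_nth; [exact: perm_mword2|rewrite size_mword].
have -> : symm tens (@mpower2 _ (u10 e) (v10 e) m n p) = symm tens (@mpower _ eta M p).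
  by apply: (symm_perm _ (p := s)) => i; rewrite mpower2E// mpowerE// ps.
have := wiener_ito_hermite intI (interleave_orthonormal orthe) Mp.
apply: filterS => w ->; rewrite big_minterleave; last first.
  (* Indices with exponent 0 contribute the neutral factor H_0 = 1, which is the initial value of
     the recurrence. *)
  move=> k Mk; have [He0 _] := hermite_recurrence (process_W X Y (eta k) w) heHe.
  by move: He0; rewrite -/M Mk fact0 divr1.
apply: eq_bigr => k _.
by rewrite !minterleaveE !interleave_double !interleave_doubleS.
Qed.

(** With e_k = e1 + i e2, the real part on the left contains - Y(e2 / sqrt 2), while W(u_k) contains
    Y(- e2 / sqrt 2). The oddness of [Y], which holds almost surely, bridges the two. *)
Lemma process_Z_normalized k : {ae P, forall w,
  (Num.sqrt 2)%:C * process_Z X Y ((Num.sqrt 2)^-1%:C *: e k) w = Wu k w +i* Wv k w}.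
Proof.
have := isonormalN isoY ((Num.sqrt 2)^-1 *: (e k).2); apply: filterS => w YN.
have r0 : (Num.sqrt 2 : R)%:C != 0.
  by rewrite (inj_eq (@complexI R) _ 0) sqrtr_eq0 -ltNge ltr0n.
rewrite /process_Z complexification_scale_real mulrC divfK//=.
rewrite /Wu /Wv /process_W /u10 /v10 /= scalerN YN -complexiE.
by simpc.
Qed.

(** The defining formula concerns the orthonormal system e_k / sqrt 2. Homogeneity of the tensor
    yields sqrt 2 to the power l + q, and this cancels the product of the factors 2^(-(j_i + k_i)/2)
    of that formula. *)
Lemma complex_wiener_ito_basis (J : nat -> nat -> R[i] -> R[i]) (l q : nat)
    (T : normedModType R[i]) (dotT : T -> T -> R[i])
    (tens : ('I_(l + q) -> complexification H) -> T) (I : T -> Omega -> R[i])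
    (j k : multiindex) :
  hilbert_tensor_power (complexification_dot dotH) dotT tens ->
  complex_wiener_ito_integral P (@complexification_conj R H)
    (complexification_dot dotH) (process_Z X Y) J tens I ->
  mdeg j = l -> mdeg k = q ->
  {ae P, forall w, I (symm_symm_power tens e ebar j k) w =
    \prod_(i <- finsupp (madd j k)) J (j i) (k i) (Wu i w +i* Wv i w)}.
Proof.
move=> tensT intI jl kq; pose r : R := Num.sqrt 2.
have r0 : r%:C != 0 :> R[i].
  by rewrite (inj_eq (@complexI R) _ 0) sqrtr_eq0 -ltNge ltr0n.
pose xi i := (Num.sqrt 2)^-1%:C *: e i.
pose f := symm_symm_power tens xi (fun i => complexification_conj (xi i)) j k.
have Bf : bisymmetric_power tens f.
  apply: closure_lspan_sub; apply: lspan_id.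
  by exists (@mpower _ xi j l),
    (@mpower _ (fun i => complexification_conj (xi i)) k q).
have -> : symm_symm_power tens e ebar j k = r%:C ^+ (l + q) *: f.
  have xiE : f = r^-1%:C ^+ (l + q) *: symm_symm_power tens e ebar j k.
    rewrite -(symm_symm_scale _ _ _ tensT); apply: symm_symm_ext => i.
      by rewrite !mpowerE.
    rewrite !mpowerE// /ebar /xi !complexification_scale_real.
    by rewrite /complexification_conj /= scalerN.
  rewrite xiE scalerA -exprMn -rmorphM mulfV ?rmorph1 ?expr1n ?scale1r//.
  by rewrite -(inj_eq (@complexI R)).
(* A countable intersection makes one null set serve all indices. *)
have hZ : {ae P, forall w, forall i, (Num.sqrt 2)%:C * process_Z X Y (xi i) w =
    Wu i w +i* Wv i w}.
  by apply/ae_foralln => i; exact: process_Z_normalized.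
have hI := complex_wiener_ito_hermite intI (normalized_orthonormal orthe) jl kq.
have hS := ae_linearZ (complex_wiener_ito_linear intI) (r%:C ^+ (l + q)) Bf.
near=> w.
rewrite (near hS w)//; have -> := near hI w; last by [].
rewrite big_split/= mulrA.
have -> : \prod_(i <- finsupp (madd j k)) (Num.sqrt 2)%:C ^- (j i + k i) =
    r%:C ^- (l + q) :> R[i].
  under eq_bigr do rewrite -exprVn; rewrite prodrXr -exprVn; congr (_ ^+ _).
  by rewrite -jl -kq -mdeg_madd; apply: eq_bigr => i _; rewrite maddE.
rewrite mulfV ?expf_neq0// mul1r; apply: eq_bigr => i _.
by rewrite (near hZ w).
Unshelve. all: by end_near. Qed.

Lemma complex_wiener_ito_kernel (J : nat -> nat -> R[i] -> R[i]) (l q : nat)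
    (T : completeNormedModType R[i]) (dotT : {dot T for @Num.conj R[i]})
    (tens : ('I_(l + q) -> complexification H) -> T) (I : T -> Omega -> R[i])
    (m n : multiindex) :
  hilbert_tensor_power (complexification_dot dotH) dotT tens ->
  complex_wiener_ito_integral P (@complexification_conj R H)
    (complexification_dot dotH) (process_Z X Y) J tens I ->
  (mdeg m + mdeg n)%N = (l + q)%N ->
  {ae P, forall w, I (kernel_g e tens m n) w =
    \sum_(j <- mbelow (madd m n) | mdeg j == l)
      \prod_(k <- finsupp (madd m n)) (hermite_coef R (m k) (n k) (j k) *
        J (j k) (m k + n k - j k)%N (Wu k w +i* Wv k w))}.
Proof.
move=> tensT intI mn.
have Bf j : bisymmetric_power tens (symm_symm_power tens e ebar j (msub (madd m n) j)).
  apply: closure_lspan_sub; apply: lspan_id.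
  by exists (@mpower _ e j l), (@mpower _ ebar (msub (madd m n) j) q).
rewrite kernel_gE.
have hS := ae_linear_sum (complex_wiener_ito_linear intI) (mbelow (madd m n))
  (Q := fun j => mdeg j == l)
  (fun j => \prod_(k <- finsupp (madd m n)) hermite_coef R (m k) (n k) (j k)) (fun j _ => Bf j).
have hB : {ae P, forall w, forall j, j \in mbelow (madd m n) -> mdeg j == l ->
    I (symm_symm_power tens e ebar j (msub (madd m n) j)) w =
    \prod_(k <- finsupp (madd m n)) J (j k) (m k + n k - j k)%N (Wu k w +i* Wv k w)}.
  apply: filter_forall_seq => j /mem_mbelow jP.
  have [jl|jl] := eqVneq (mdeg j) l; last by apply: aeW => w.
  have kq : mdeg (msub (madd m n) j) = q by rewrite mdeg_msub// mdeg_madd mn jl addKn.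
  have := complex_wiener_ito_basis tensT intI jl kq; apply: filterS => w hw _.
  rewrite hw msubK//; apply: eq_bigr => k _.
  by rewrite msubE maddE.
near=> w; rewrite (near hS w)//.
rewrite big_seq_cond [RHS]big_seq_cond; apply: eq_bigr => j /andP[jin jl].
by rewrite (near hB w _ j)// [RHS]big_split/=.
Unshelve. all: by end_near. Qed.

End BasisElements.

(** Summing over l and then over |j| = l amounts to summing over all j <= m + n. That sum of
    products factors over k, and each factor is the two-variable identity at x = W(u_k), y =
    W(v_k). *)
Lemma complex_wiener_ito_expansion (R : realType) d (Omega : measurableType d)
    (P : probability Omega R) (H : completeNormedModType R)
    (dotH : {dot H for @idfun R}) (X Y : H -> {RV P >-> R})
    (isoY : isonormal dotH Y) (He : nat -> R -> R) (J : nat -> nat -> R[i] -> R[i])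
    (p : nat) (T : normedModType R)
    (tens : ('I_p -> (H * H)%type) -> T) (I : T -> {RV P >-> R})
    (TC : nat -> completeNormedModType R[i])
    (dotTC : forall n, {dot (TC n) for @Num.conj R[i]})
    (tensC : forall n, ('I_n -> complexification H) -> TC n)
    (IC : forall l q, TC (l + q)%N -> Omega -> R[i])
    (e : nat -> complexification H) (m n : multiindex) :
  hermite_polynomials He -> complex_hermite_polynomials J ->
  wiener_ito_integral (dsum_dot dotH) (process_W X Y) He tens I ->
  (forall n, hilbert_tensor_power (complexification_dot dotH) (dotTC n) (@tensC n)) ->
  (forall l q, complex_wiener_ito_integral P (@complexification_conj R H)
     (complexification_dot dotH) (process_Z X Y) J (@tensC (l + q)%N) (@IC l q)) ->
  complete_orthogonal (complexification_dot dotH) 2 e ->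
  (mdeg m + mdeg n)%N = p ->
  {ae P, forall w, (I (symm tens (@mpower2 _ (u10 e) (v10 e) m n p)) w)%:C =
    \sum_(l < p.+1) IC l (p - l)%N (kernel_g e (@tensC (l + (p - l))%N) m n) w}.
Proof.
move=> heHe heJ intI tensTC intIC orthe mnp.
have hI := wiener_ito_basis orthe heHe intI mnp.
have hK : {ae P, forall w, forall l : 'I_p.+1,
    IC l (p - l)%N (kernel_g e (@tensC (l + (p - l))%N) m n) w =
    \sum_(j <- mbelow (madd m n) | mdeg j == l)
      \prod_(k <- finsupp (madd m n)) (hermite_coef R (m k) (n k) (j k) *
        J (j k) (m k + n k - j k)%N
          (process_W X Y (u10 e k) w +i* process_W X Y (v10 e k) w))}.
  apply: filter_forall => l.
  apply: (complex_wiener_ito_kernel isoY orthe (tensTC _) (intIC _ _)).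
  by rewrite mnp subnKC// -ltnS.
apply: filterS2 hI hK => w -> hKw; rewrite (eq_bigr _ (fun l _ => hKw l)).
rewrite (exchange_big_dep predT)//= [RHS]big_seq_cond.
under [RHS]eq_bigr => j /andP[/mem_mbelow jP _].
  rewrite (big_pred1 (inord (mdeg j))); last first.
    move=> l; rewrite /= -val_eqE/= inordK 1?eq_sym//.
    by rewrite ltnS -mnp -mdeg_madd leq_mdeg.
over.
rewrite -big_seq_cond rmorph_prod.
pose F k i := hermite_coef R (m k) (n k) i * J i (m k + n k - i)%N
  (process_W X Y (u10 e k) w +i* process_W X Y (v10 e k) w).
rewrite -[RHS]/(\sum_(j <- mbelow (madd m n)) \prod_(k <- finsupp (madd m n)) F k (j k)).
rewrite (sum_mbelow (madd m n) F); apply: eq_bigr => k _.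
by rewrite maddE -(hermite_mul heHe heJ).
Qed.

(** * Passage to the limit *)

Section Limits.
Context d (Omega : measurableType d) (R : realType) (P : probability Omega R).

(** [D] is fixed while its decomposition varies with delta, so its second moment lies below every
    eps. *)
Lemma ae_eq0_of_approx n (D : Omega -> R) : measurable_fun setT D ->
  (forall delta : R, 0 < delta ->
     exists (a : Omega -> R) (f : 'I_n -> Omega -> R),
       [/\ measurable_fun setT a, forall l, measurable_fun setT (f l),
           (\int[P]_w ((a w) ^+ 2)%:E <= delta%:E)%E,
           forall l, (\int[P]_w ((f l w) ^+ 2)%:E <= delta%:E)%E &
           {ae P, forall w, D w = a w - \sum_(l < n) f l w}]) ->
  {ae P, forall w, D w = 0}.
Proof.
move=> mD approx; apply: msq_eq0_ae => // eps eps0.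
(* 4^n is the cost of summing the n terms, and 2 that of adding [a]. *)
pose delta := eps / (2 * (1 + (4 ^+ n))).
have n0 : 0 < 2 * (1 + 4 ^+ n) :> R by rewrite mulr_gt0// addr_gt0 ?exprn_gt0.
have delta0 : 0 < delta by rewrite divr_gt0.
have [a [f [ma mf sa sf Daf]]] := approx _ delta0.
have mfN l : measurable_fun setT (fun w => - f l w) by exact: measurableT_comp.
have sfN l : (\int[P]_w ((- f l w) ^+ 2)%:E <= delta%:E)%E.
  by under eq_integral do rewrite sqrrN.
pose S w := \sum_(l < n) - f l w.
have mS : measurable_fun setT S by exact: measurable_fun_sumr.
have msS : (\int[P]_w ((S w) ^+ 2)%:E <= (4 ^+ n * delta)%:E)%E.
  have := msq_sum (index_enum 'I_n) (ltW delta0) mfN sfN.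
  have -> : size (index_enum 'I_n) = n by rewrite -sum1_size sum_nat_const card_ord muln1.
  by [].
rewrite (ae_eq_msq mD (measurable_funD ma mS)); last first.
  by apply: filterS Daf => w ->; rewrite -sumrN.
apply: le_trans (msqD ma mS sa msS) _.
rewrite lee_fin le_eqVlt; apply/orP; left; apply/eqP.
by rewrite /delta; field; rewrite ?gt_eqF// addr_gt0 ?exprn_gt0.
Qed.

Context (V : lmodType R[i]) (conjV : V -> V) (dotV : V -> V -> R[i]).
Context (Z : V -> Omega -> R[i]) (J : nat -> nat -> R[i] -> R[i]).
Context (T : normedModType R[i]) (p q : nat).
Context (tens : ('I_(p + q) -> V) -> T) (I : T -> Omega -> R[i]).
Hypothesis (intI : complex_wiener_ito_integral P conjV dotV Z J tens I).

Lemma complex_wiener_ito_msq f : bisymmetric_power tens f ->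
  (\int[P]_w ((complex.Re (I f w)) ^+ 2)%:E <=
     ((p`! * q`!)%:R * complex.Re (`|f| ^+ 2))%:E)%E /\
  (\int[P]_w ((complex.Im (I f w)) ^+ 2)%:E <=
     ((p`! * q`!)%:R * complex.Re (`|f| ^+ 2))%:E)%E.
Proof.
move=> Bf; rewrite -(complex_wiener_ito_isometry intI Bf) unlock.
have [mRe mIm] := complex_wiener_ito_measurable intI Bf.
have normcE w : Normc.normc (I f w) ^+ 2 =
    complex.Re (I f w) ^+ 2 + complex.Im (I f w) ^+ 2.
  by case: (I f w) => x y /=; rewrite sqr_sqrtr// addr_ge0 ?sqr_ge0.
under [X in (_ <= X)%E /\ _]eq_integral do rewrite normcE.
under [X in _ /\ (_ <= X)%E]eq_integral do rewrite normcE.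
by split; apply: ge0_le_integral => //; try exact: measurable_sq;
  try (by apply/measurable_EFinP/measurable_funD; exact: measurable_funX);
  move=> w _; rewrite lee_fin ?sqr_ge0// (lerDl, lerDr) sqr_ge0.
Qed.

End Limits.

Lemma partial_sum_complexify (R : realType) (V : lmodType R) (I : choiceType)
    (A : set I) (c : I -> R[i]) (f : I -> V) (X : {fset I}) :
  partial_sum (patch (fun=> 0) A (fun i => c i *: complexify (f i))) X =
  (\sum_(i <- X | i \in A) complex.Re (c i) *: f i,
   \sum_(i <- X | i \in A) complex.Im (c i) *: f i) :> complexification V.
Proof.
rewrite partial_sum_patch; elim/big_rec3: _ => // i x y z iA ->.
rewrite [c i *: _]/(complexification_scale (c i) (complexify (f i))).
by rewrite /complexification_scale /= !scaler0 subr0 addr0.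
Qed.

Lemma complex_sum (R : rcfType) (I : Type) (s : seq I) (Q : pred I) (x y : I -> R) :
  (\sum_(i <- s | Q i) x i) +i* (\sum_(i <- s | Q i) y i) =
  \sum_(i <- s | Q i) (x i +i* y i).
Proof. by elim/big_rec3: _ => // i u v z _ <-. Qed.

Theorem theorem4p1
  (R : realType)
  (d : measure_display) (Omega : measurableType d) (P : probability Omega R)
  (H : completeNormedModType R) (dotH : {dot H for @idfun R})
  (HH : hilbert_dot dotH) (sepH : separable_space H)
  (X Y : H -> {RV P >-> R})
  (isoX : isonormal dotH X) (isoY : isonormal dotH Y)
  (indXY : independent_processes X Y)
  (He : nat -> R -> R) (heHe : hermite_polynomials He)
  (J : nat -> nat -> R[i] -> R[i]) (heJ : complex_hermite_polynomials J)
  (p : nat)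
  (T : completeNormedModType R) (dotT : {dot T for @idfun R})
  (HT : hilbert_dot dotT)
  (tens : ('I_p -> (H * H)%type) -> T)
  (tensT : hilbert_tensor_power (dsum_dot dotH) dotT tens)
  (I : T -> {RV P >-> R})
  (intI : wiener_ito_integral (dsum_dot dotH) (process_W X Y) He tens I)
  (TC : nat -> completeNormedModType R[i])
  (dotTC : forall n, {dot (TC n) for @Num.conj R[i]})
  (HTC : forall n, hilbert_dot (dotTC n))
  (tensC : forall n, ('I_n -> complexification H) -> TC n)
  (tensTC : forall n, hilbert_tensor_power (complexification_dot dotH)
                        (dotTC n) (@tensC n))
  (IC : forall l q, TC (l + q)%N -> Omega -> R[i])
  (intIC : forall l q, complex_wiener_ito_integral P
             (@complexification_conj R H) (complexification_dot dotH)
             (process_Z X Y) J (@tensC (l + q)%N) (@IC l q))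
  (e : nat -> complexification H)
  (orthe : complete_orthogonal (complexification_dot dotH) 2 e)
  (g1 g2 : T) (symg1 : symmetric_power tens g1)
  (symg2 : symmetric_power tens g2)
  (c : multiindex * multiindex -> R[i]) :
  let A := [set mn : multiindex * multiindex |
              (mdeg mn.1 + mdeg mn.2)%N = p] in
  (\esum_(mn in A) (Normc.normc (c mn) ^+ 2)%:E < +oo)%E ->
  partial_sum (patch (fun=> 0) A (fun mn =>
      c mn *: complexify
        (symm tens (@mpower2 _ (u10 e) (v10 e) mn.1 mn.2 p)))) @ totally
    --> ((g1, g2) : complexification T) ->
  exists gt : forall l : nat, TC (l + (p - l))%N,
    (forall l, (l <= p)%N ->
       bisymmetric_power (@tensC (l + (p - l))%N) (gt l) /\
       partial_sum (patch (fun=> 0) A (fun mn =>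
           c mn *: kernel_g e (@tensC (l + (p - l))%N) mn.1 mn.2)) @ totally
         --> gt l) /\
    {ae P, forall w,
       I g1 w +i* I g2 w = \sum_(l < p.+1) IC l (p - l)%N (gt l) w}.
Proof.
move=> A csum cg.
have totF : ProperFilter (@totally (multiindex * multiindex)%type) := totally_filter.
pose S mn := symm tens (@mpower2 _ (u10 e) (v10 e) mn.1 mn.2 p).
pose kg l mn := kernel_g e (@tensC (l + (p - l))%N) mn.1 mn.2.
pose SK l := partial_sum (patch (fun=> 0) A (fun mn => c mn *: kg l mn)).
(* The kernel lemmas speak of degree l + q; with truncated subtraction, l + (p - l) equals p only
   for l <= p. *)
have AE l : (l <= p)%N ->
    A = [set mn | (mdeg mn.1 + mdeg mn.2)%N = (l + (p - l))%N].
  by move=> lp; rewrite subnKC.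
have gtP l : exists gt : TC (l + (p - l))%N, (l <= p)%N ->
    bisymmetric_power (@tensC (l + (p - l))%N) gt /\ SK l @ totally --> gt.
  (* For l > p nothing is asked of the kernel, and 0 serves as a value. *)
  case: (leqP l p) => lp; last by exists 0.
  have [|gt Bgt cvgt] := kernel_series_cvg orthe (HTC _) (tensTC (l + (p - l))%N)
    (c := c); first by rewrite -AE.
  by exists gt => _; split=> //; move: cvgt; rewrite -AE.
pose gt l := sval (cid (gtP l)).
have Bgt l : (l <= p)%N -> bisymmetric_power (@tensC (l + (p - l))%N) (gt l).
  by move=> /(svalP (cid (gtP l)))[].
have cvgt l : (l <= p)%N -> SK l @ totally --> gt l.
  by move=> /(svalP (cid (gtP l)))[].
exists gt; split=> [l lp|]; first by split; [exact: Bgt|exact: cvgt].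
(* The integral [I] takes real tensors, so a partial sum is split into its two real components. *)
pose fR F := \sum_(mn <- F | mn \in A) complex.Re (c mn) *: S mn.
pose fI F := \sum_(mn <- F | mn \in A) complex.Im (c mn) *: S mn.
have BS mn : symmetric_power tens (S mn).
  by apply: closure_lspan_sub; apply: lspan_id; eexists.
have BfR (F : {fset _}) : symmetric_power tens (fR F).
  apply: closure_lspan_sub; apply: lspan_sum => mn _.
  by apply: lspan_id; eexists.
have BfI (F : {fset _}) : symmetric_power tens (fI F).
  apply: closure_lspan_sub; apply: lspan_sum => mn _.
  by apply: lspan_id; eexists.
have BSK l F : (l <= p)%N -> bisymmetric_power (@tensC (l + (p - l))%N) (SK l F).
  move=> lp; apply: closure_lspan_sub.
  have := @kernel_series_bisymmetric _ _ e _ _ _ (@tensC (l + (p - l))%N) c F.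
  by rewrite -AE.
have linI := wiener_ito_linear intI.
have linIC l := complex_wiener_ito_linear (intIC l (p - l)%N).
have [cR cI] : (fR F @[F --> totally] --> g1) /\ (fI F @[F --> totally] --> g2).
  have psE : partial_sum (patch (fun=> 0) A (fun mn => c mn *: complexify (S mn))) =
      fun F => (fR F, fI F) by apply/funext => F; exact: partial_sum_complexify.
  move: cg; rewrite psE => cg; split.
    exact: (cvg_comp _ _ cg (@cvg_fst _ _ _ _ _)).
  exact: (cvg_comp _ _ cg (@cvg_snd _ _ _ _ _)).
have finite_identity (F : {fset _}) : {ae P, forall w,
    I (fR F) w +i* I (fI F) w = \sum_(l < p.+1) IC l (p - l)%N (SK l F) w}.
  have hR := ae_linear_sum linI F (Q := mem A) (fun mn => complex.Re (c mn)) (fun mn _ => BS mn).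
  have hI := ae_linear_sum linI F (Q := mem A) (fun mn => complex.Im (c mn)) (fun mn _ => BS mn).
  have hS : {ae P, forall w, forall mn, mn \in (F : seq _) -> mn \in A ->
      (I (S mn) w)%:C = \sum_(l < p.+1) IC l (p - l)%N (kg l mn) w}.
    apply: filter_forall_seq => mn _.
    case: (boolP (mn \in A)) => mnA; last by apply: aeW.
    have := complex_wiener_ito_expansion isoY heHe heJ intI tensTC intIC orthe (set_mem mnA).
    by apply: filterS.
  have hK : {ae P, forall w, forall l : 'I_p.+1, IC l (p - l)%N (SK l F) w =
      \sum_(mn <- F | mn \in A) c mn * IC l (p - l)%N (kg l mn) w}.
    apply: filter_forall => l; rewrite /SK partial_sum_patch.
    apply: (ae_linear_sum (linIC l)) => mn /set_mem mnA.
    apply: closure_lspan_sub; apply: kernel_g_bisymmetric.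
    by rewrite mnA subnKC// -ltnS.
  apply: filterS2 (filterI hR hI) (filterI hS hK) => w [-> ->] [hSw hKw].
  rewrite [RHS](eq_bigr _ (fun l _ => hKw l)).
  rewrite exchange_big/= complex_sum big_seq_cond [RHS]big_seq_cond.
  apply: eq_bigr => mn /andP[mnF mnA].
  rewrite -mulr_sumr -hSw//.
  by case: (c mn) => x y; simpc.
(* Real and imaginary parts go through the same limit argument, with [part] standing for either one;
   all estimates thus stay among real random variables. *)
have approx (part : {additive R[i] -> R}) (g : T) (f : {fset _} -> T) :
    symmetric_power tens g -> (forall F, symmetric_power tens (f F)) ->
    f F @[F --> totally] --> g ->
    (forall F, {ae P, forall w, I (f F) w =
       part (\sum_(l < p.+1) IC l (p - l)%N (SK l F) w)}) ->
    (forall l h, bisymmetric_power (@tensC (l + (p - l))%N) h ->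
       measurable_fun setT (fun w => part (IC l (p - l)%N h w)) /\
       (\int[P]_w ((part (IC l (p - l)%N h w)) ^+ 2)%:E <=
          ((l`! * (p - l)`!)%:R * complex.Re (`|h| ^+ 2))%:E)%E) ->
    {ae P, forall w, I g w - \sum_(l < p.+1) part (IC l (p - l)%N (gt l) w) = 0}.
  move=> symg symf fg If msqpart; apply: (@ae_eq0_of_approx _ _ _ _ p.+1).
    apply: measurable_funB => //; apply: measurable_fun_sumr => l.
    by apply: (msqpart _ _ _).1; apply: Bgt; rewrite -ltnS.
  (* Since eta <= 1, p! eta^2 <= p! eta <= delta, which avoids a square root. *)
  move=> delta delta0; pose eta := Num.min 1 (delta / p`!%:R).
  have p0 : 0 < p`!%:R :> R by rewrite ltr0n fact_gt0.
  have eta0 : 0 < eta by rewrite lt_min ltr01 divr_gt0.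
  have eta2 : p`!%:R * eta ^+ 2 <= delta.
    rewrite mulrC -ler_pdivlMr// expr2; apply: (@le_trans _ _ (1 * eta)).
      by rewrite ler_wpM2r ?(ltW eta0)// ge_min lexx.
    by rewrite mul1r ge_min lexx orbT.
  have near_g : \forall F \near totally, `|g - f F| < eta.
    exact: (@cvgr_dist_lt _ _ _ _ totally_filter _ _ fg _ eta0).
  have near_gt : \forall F \near totally, forall l : 'I_p.+1,
      `|gt l - SK l F| < eta%:C.
    apply: filter_forall => l.
    apply: (@cvgr_dist_lt _ _ _ _ totally_filter _ _ (cvgt l (ltn_ord l))).
    by rewrite ltcR.
  (* A single finite [F] approximates the tensor and all p + 1 kernels at once. *)
  have [F [gF gtF]] := filter_ex (filterI near_g near_gt).
  have Bsub l : (l <= p)%N ->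
      bisymmetric_power (@tensC (l + (p - l))%N) (gt l - SK l F).
    move=> lp; rewrite -[gt l - _]addrC -scaleN1r.
    by apply: closure_lspan_linear; [exact: BSK|exact: Bgt].
  have symsub : symmetric_power tens (g - f F).
    rewrite -[g - _]addrC -scaleN1r.
    by apply: closure_lspan_linear; [exact: symf|exact: symg].
  (* The identity for finite sums at [F] cancels the approximants, so the difference of the limits
     is the difference of these error terms, each small in second moment by isometry. *)
  exists (I (g - f F)), (fun (l : 'I_p.+1) w => part (IC l (p - l)%N (gt l - SK l F) w)).
  split=> //.
  - by move=> l; apply: (msqpart _ _ _).1; apply: Bsub; rewrite -ltnS.
  - have := wiener_ito_isometry intI symsub; rewrite unlock => ->.
    rewrite lee_fin; apply: le_trans eta2; rewrite ler_wpM2l ?ler0n//.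
    by rewrite lerXn2r// ?qualifE/= ?normr_ge0 ?(ltW eta0)// ltW.
  - move=> l; have lp : (l <= p)%N by rewrite -ltnS.
    apply: (le_trans (msqpart _ _ (Bsub _ lp)).2).
    rewrite lee_fin; apply: le_trans eta2.
    apply: ler_pM; rewrite ?ler0n//.
    + case/complex_realP: (normr_real (gt l - SK l F)) => x ->.
      by rewrite -rmorphXn/= sqr_ge0.
    (* l! (p-l)! is at most p!, the quotient being a binomial coefficient. *)
    + rewrite ler_nat -(bin_fact lp) leq_pmull// bin_gt0//.
    + have := gtF l; have := normr_ge0 (gt l - SK l F).
      case/complex_realP: (normr_real (gt l - SK l F)) => x ->.
      rewrite lecR ltcR -rmorphXn/= => x0 xeta.
      by rewrite lerXn2r// ?qualifE/= ?(ltW eta0)// ltW.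
  - have hI := ae_linearB linI symg (symf F).
    have hF := If F.
    have hK : {ae P, forall w, forall l : 'I_p.+1,
        IC l (p - l)%N (gt l - SK l F) w = IC l (p - l)%N (gt l) w - IC l (p - l)%N (SK l F) w}.
      apply: filter_forall => l; have lp : (l <= p)%N by rewrite -ltnS.
      exact: (ae_linearB (linIC l) (Bgt _ lp) (BSK _ _ lp)).
    apply: filterS2 (filterI hI hF) hK => w [-> ->] hKw; rewrite (raddf_sum part).
    rewrite [X in _ = _ - X](eq_bigr (fun l : 'I_p.+1 =>
      part (IC l (p - l)%N (gt l) w) - part (IC l (p - l)%N (SK l F) w))).
      by rewrite sumrB opprB addrA subrK.
    by move=> l _; rewrite hKw raddfB.
have hR : {ae P, forall w, I g1 w -
    \sum_(l < p.+1) complex.Re (IC l (p - l)%N (gt l) w) = 0}.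
  apply: (approx (@complex.Re R) g1 fR) => //.
    by move=> F; apply: filterS (finite_identity F) => w <-.
  move=> l h Bh; split; first exact: (complex_wiener_ito_measurable (intIC _ _) Bh).1.
  exact: (complex_wiener_ito_msq (intIC _ _) Bh).1.
have hI : {ae P, forall w, I g2 w -
    \sum_(l < p.+1) complex.Im (IC l (p - l)%N (gt l) w) = 0}.
  apply: (approx (@complex.Im R) g2 fI) => //.
    by move=> F; apply: filterS (finite_identity F) => w <-.
  move=> l h Bh; split; first exact: (complex_wiener_ito_measurable (intIC _ _) Bh).2.
  exact: (complex_wiener_ito_msq (intIC _ _) Bh).2.
apply: filterS2 hR hI => w /eqP + /eqP; rewrite !subr_eq0 => /eqP -> /eqP ->.
rewrite complex_sum; apply: eq_bigr => l _.
by case: (IC _ _ _ _).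
Qed.
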